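(* Let $\beta\ge0$ and let $h$ be a smooth function with $p(\rho)=\rho h'(\rho)-h(\rho)$. Let $(\rho,u)$, with $c=\mathcal K*\rho$, and $(\bar\rho,\bar u)$, with $\bar c=\mathcal K*\bar\rho$, be two smooth solutions, with positive densities, on $\mathbb T^d$ of the Euler--Poisson system $$\frac{\partial\rho}{\partial t}+\operatorname{div}(\rho u)=0,\qquad\rho\Big(\frac{\partial u}{\partial t}+(u\cdot\nabla)u\Big)=-\nabla p(\rho)+\rho\nabla c,\qquad-\triangle c+\beta c=\rho-\langle\rho\rangle .$$ Then \begin{align*} &\frac{d}{dt}\int\Big(h(\rho|\bar\rho)-\tfrac12(\rho-\bar\rho)\,\mathcal K*(\rho-\bar\rho)+\tfrac12\rho|u-\bar u|^2\Big)dx\\ &\quad=\int\operatorname{div}\bar u\,\Big(-p(\rho|\bar\rho)+\tfrac12|\nabla(c-\bar c)|^2+\tfrac\beta2(c-\bar c)^2+\langle\rho-\bar\rho\rangle(c-\bar c)\Big)dx\\ &\qquad-\int\nabla\bar u:\nabla(c-\bar c)\otimes\nabla(c-\bar c)\,dx-\int\rho\,\nabla\bar u:(u-\bar u)\otimes(u-\bar u)\,dx . \end{align*}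
   Context: $\mathbb T^d$ is the flat torus of total measure one, integrals are over $\mathbb T^d$, and $\langle\rho\rangle=\int\rho\,dx$ is the average of $\rho$. $\mathcal K$ is the (symmetric) Green's function of the elliptic problem $-\triangle c+\beta c=\rho-\langle\rho\rangle$ on $\mathbb T^d$, i.e. $c=\mathcal K*\rho$ is its unique solution if $\beta>0$, and its unique solution normalized by $\int c\,dx=0$ if $\beta=0$; $(\mathcal K*\rho)(x)=\int\mathcal K(x-y)\rho(y)\,dy$. For a function $g$ of $\rho$, $g(\rho|\bar\rho)=g(\rho)-g(\bar\rho)-g'(\bar\rho)(\rho-\bar\rho)$. $(\nabla\bar u)_{ij}=\partial\bar u_i/\partial x_j$, $A:B=\sum_{i,j}A_{ij}B_{ij}$, $(a\otimes b)_{ij}=a_ib_j$. *)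

(* Defs.v *)
From HB Require Import structures.
From mathcomp Require Import all_boot all_order all_algebra.
From mathcomp Require Import all_classical all_reals all_analysis.

Set Implicit Arguments.
Unset Strict Implicit.
Unset Printing Implicit Defensive.

Import Order.TTheory GRing.Theory Num.Theory.
Import numFieldNormedType.Exports.

Local Open Scope classical_set_scope.
Local Open Scope ring_scope.

(* Functions on the torus T^d = R^d/Z^d are functions on R^d = 'rV[R]_d that
   are 1-periodic in each coordinate.  The norm of 'rV[R]_d is the sup norm, so it
   is used for the topology only: Euclidean quantities go through [dot]. *)

Section torus_measure.
Context (R : realType).

Definition tuple_cons (d : nat)
  (z : measurableTypeR R * d.-tuple (measurableTypeR R)) :
  d.+1.-tuple (measurableTypeR R) := [tuple of z.1 :: z.2].

Lemma measurable_tuple_cons d : measurable_fun setT (@tuple_cons d).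
Proof. exact: (measurable_cons measurable_fst measurable_snd). Qed.

HB.instance Definition _ d := @isMeasurableFun.Build _ _ _ _ (@tuple_cons d)
  (@measurable_tuple_cons d).

(* The d-fold product of the Lebesgue measure of [0, 1]: the normalized Lebesgue
   measure of the torus, carried by the fundamental domain [0, 1]^d. *)
Fixpoint torus_prob (d : nat) : probability (d.-tuple (measurableTypeR R)) R :=
  match d with
  | 0 => \d_([tuple] : 0.-tuple (measurableTypeR R))
  | d'.+1 => distribution (uniform_prob (@ltr01 R) \x torus_prob d')%E
               (@tuple_cons d')
  end.

Definition row_of_tuple (d : nat) (s : d.-tuple (measurableTypeR R)) : 'rV[R]_d :=
  \row_i tnth s i.

Definition tint (d : nat) (f : 'rV[R]_d -> R) : R :=
  \int[torus_prob d]_s f (row_of_tuple s).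

Definition torus_integrable (d : nat) (f : 'rV[R]_d -> R) : Prop :=
  (torus_prob d).-integrable setT (fun s => (f (row_of_tuple s))%:E).

End torus_measure.

Section torus_calculus.
Context (R : realType).

Fixpoint Ck_on (V W : normedModType R) (k : nat) (U : set V) (f : V -> W) : Prop :=
  match k with
  | 0 => forall x, U x -> {for x, continuous f}
  | k'.+1 => (forall x, U x -> differentiable f x) /\
             (forall v, Ck_on k' U ('D_v f))
  end.

(* Meaningful for open [U]. *)
Definition smooth_on (V W : normedModType R) (U : set V) (f : V -> W) : Prop :=
  forall k, Ck_on k U f.

Context (d : nat).
Implicit Types (f K r c : 'rV[R]_d -> R) (v w : 'rV[R]_d -> 'rV[R]_d).
Implicit Types (a b : 'rV[R]_d) (A B : 'M[R]_d).

Definition unit_vec (i : 'I_d) : 'rV[R]_d := delta_mx 0 i.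

Definition torus_periodic (T : Type) (f : 'rV[R]_d -> T) : Prop :=
  forall x i, f (x + unit_vec i) = f x.

Definition dot a b : R := \sum_i a 0 i * b 0 i.
Definition sqnorm a : R := dot a a.
Definition ddot A B : R := \sum_i \sum_j A i j * B i j.
Definition tensor a b : 'M[R]_d := \matrix_(i, j) (a 0 i * b 0 j).

Definition partial (i : 'I_d) f : 'rV[R]_d -> R := 'D_(unit_vec i) f.
Definition grad f (x : 'rV[R]_d) : 'rV[R]_d := \row_i partial i f x.
Definition lap f (x : 'rV[R]_d) : R := \sum_i partial i (partial i f) x.
Definition diverg v (x : 'rV[R]_d) : R := \sum_i partial i (fun y => v y 0 i) x.
(* Rows are indexed by components, columns by directions of differentiation:
   this is the transpose of the library's [jacobian]. *)
Definition gradv v (x : 'rV[R]_d) : 'M[R]_d :=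
  \matrix_(i, j) partial j (fun y => v y 0 i) x.
Definition advect v w (x : 'rV[R]_d) : 'rV[R]_d :=
  \row_i \sum_j v x 0 j * partial j (fun y => w y 0 i) x.

(* tint f is also the mean of f, since the torus has total measure one. *)
Definition mean f : R := tint f.

Definition tconv K r (x : 'rV[R]_d) : R := tint (fun y => K (x - y) * r y).

Definition elliptic_eq (beta : R) r c : Prop :=
  forall x, - lap c x + beta * c x = r x - mean r.

Record elliptic_solution (beta : R) r c : Prop := {
  elliptic_periodic : torus_periodic c;
  elliptic_smooth : smooth_on setT c;
  elliptic_pde : elliptic_eq beta r c;
  elliptic_normalized : beta = 0 -> tint c = 0 }.

(* Uniqueness of the elliptic solution is a consequence of the equation, not
   part of the definition. *)
Record green_function (beta : R) K : Prop := {
  green_periodic : torus_periodic K;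
  green_integrable : torus_integrable K;
  green_symmetric : forall x, K (- x) = K x;
  green_solves : forall r, torus_periodic r -> smooth_on setT r ->
    elliptic_solution beta r (tconv K r) }.

(* g(r|s) *)
Definition relative (g : R -> R) (r s : R) : R := g r - g s - derive1 g s * (r - s).

Definition pressure (h : R -> R) (r : R) : R := r * derive1 h r - h r.

(* The fields rho, u, c are functions of the time t, ranging over an open set I,
   and of the position x; smoothness of rho and u is joint in (t, x). *)
Record euler_poisson (beta : R) (h : R -> R) (I : set R)
    (rho : R -> 'rV[R]_d -> R) (u : R -> 'rV[R]_d -> 'rV[R]_d)
    (c : R -> 'rV[R]_d -> R) : Prop := {
  ep_rho_periodic : forall t, I t -> torus_periodic (rho t);
  ep_u_periodic : forall t, I t -> torus_periodic (u t);
  ep_rho_smooth : smooth_on (I `*` setT) (fun z : R * 'rV[R]_d => rho z.1 z.2);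
  ep_u_smooth : smooth_on (I `*` setT) (fun z : R * 'rV[R]_d => u z.1 z.2);
  ep_rho_gt0 : forall t x, I t -> 0 < rho t x;
  ep_mass : forall t x, I t ->
    derive1 (fun s => rho s x) t + diverg (fun y => rho t y *: u t y) x = 0;
  ep_momentum : forall t x, I t ->
    rho t x *: (derive1 (fun s => u s x) t + advect (u t) (u t) x) =
    - grad (fun y => pressure h (rho t y)) x + rho t x *: grad (c t) x;
  ep_poisson : forall t, I t -> elliptic_eq beta (rho t) (c t) }.

End torus_calculus.

(* Main.v *)
Require Import Defs.
From mathcomp Require Import all_boot all_order all_algebra.
From mathcomp Require Import all_classical all_reals all_analysis.
From mathcomp Require Import measurable_realfun ring.

Set Implicit Arguments.
Unset Strict Implicit.
Unset Printing Implicit Defensive.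

Import Order.TTheory GRing.Theory Num.Theory.
Import numFieldNormedType.Exports.

Local Open Scope classical_set_scope.
Local Open Scope ring_scope.

(** The proof follows the classical relative entropy computation.  Write
    r = rho - rhob, C = c - cb = K * r, U = u - ub, and let m be the mean of r.

    Time derivative.  The part h(rho|rhob) + rho |U|^2 / 2 of the energy is a
    C^1 function of (t, x), so its integral is differentiated under the integral
    sign ([is_derive_tint_jC1]).  The interaction energy N(s) = int r(s) C(s)
    is quadratic in r, and the solution operator of the elliptic problem is
    symmetric ([elliptic_symmetric]), hence
    N(s) - N(t) = 2 int (r(s) - r(t)) C(t) + int (r(s) - r(t)) (C(s) - C(t)),
    where the last term is O((s - t)^2) because convolution with the integrable
    kernel K is bounded for the sup norm.  Thus N' = 2 int (d_t r) C
    ([is_derive_interaction]), and the time derivative falls on r only.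

    Space balance.  Substituting the equations, the integrand of the time
    derivative and the integrand of the right-hand side differ, at every point,
    by the divergence of an explicit flux ([relative_energy_pointwise]).  The
    thermodynamic part rests on grad p(rho) = rho grad h'(rho); the interaction
    part on writing r = - lap C + beta C + m, so that r grad C is the divergence
    of a stress tensor plus the gradient of beta C^2 / 2 + m C; this step uses
    the symmetry of the second derivatives of C ([dir_commute]).

    Divergences integrate to zero over the torus ([tint_divergence]).  This is
    deduced from the translation invariance of the torus measure
    ([ge0_integral_torus_shift]): the integral of x |-> f(x + s e) does not
    depend on s, and its derivative at s = 0 is the integral of a partial
    derivative.  The same invariance gives the bound on the convolution. *)

(** * Translation invariance of the torus measure *)
Section lebesgue_shift.
Context (R : realType).
Local Notation mu := (@lebesgue_measure R).
Implicit Types (g : measurableTypeR R -> \bar R).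

Lemma measurable_shift (a : R) : measurable_fun setT
  ((fun x => x + a) : measurableTypeR R -> measurableTypeR R).
Proof. exact: (@measurable_funD _ (measurableTypeR R) R setT id (cst a)). Qed.

(** Both measures give the same length to half-open intervals, and these
    determine a Borel measure. *)
Lemma lebesgue_measure_shift (a : R) (A : set (measurableTypeR R)) :
  measurable A ->
  pushforward mu ((fun x => x + a)%R : measurableTypeR R -> measurableTypeR R) A
  = mu A.
Proof.
move=> mA; have mf := measurable_shift a.
pose nu := [the {measure set _ -> \bar R} of pushforward mu
  ((fun x => x + a) : measurableTypeR R -> measurableTypeR R)].
rewrite -[LHS]/(nu mf A); apply: esym; apply: (@lebesgue_measure_unique R (nu mf)) => // _ [[u v]] _ <-.
rewrite /nu /=.
rewrite /pushforward /=.
have -> : (fun x => x + a) @^-1` [set` `]u, v]] = [set` `]u - a, v - a]].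
  by apply/seteqP; split => x /=; rewrite !in_itv/= ltrBlDr lerBrDr.
rewrite !lebesgue_measure_itv/= !lte_fin ltrD2r.
by case: ifP => //; rewrite -!EFinB => _; congr EFin; rewrite opprB addrA subrK.
Qed.

Lemma ge0_integral_shift (a : R) g (i : interval R) :
  measurable_fun setT g -> (forall x, 0 <= g x)%E ->
  (\int[mu]_(x in [set` i]) g x =
   \int[mu]_(x in (fun x => x + a)%R @^-1` [set` i]) g (x + a)%R)%E.
Proof.
move=> mg g0; have mf := measurable_shift a.
have mi : (measurable ([set` i] : set (measurableTypeR R))) by [].
transitivity (\int[pushforward mu ((fun x => x + a)%R : measurableTypeR R ->
   measurableTypeR R)]_(x in [set` i]) g x)%E.
  apply: eq_measure_integral => /= A mA _.
  by rewrite lebesgue_measure_shift.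
by rewrite ge0_integral_pushforward//; exact: measurable_funTS.
Qed.

(** By periodicity only the fractional part b of a matters; the piece of
    [b, 1 + b[ beyond 1 is then brought back to [0, b[. *)
Lemma ge0_integral_unit_shift (a : R) g :
  measurable_fun setT g -> (forall x, 0 <= g x)%E ->
  (forall x (z : int), g (x + z%:~R) = g x) ->
  (\int[mu]_(x in `[0%R, 1%R]) g (x + a)%R = \int[mu]_(x in `[0%R, 1%R]) g x)%E.
Proof.
move=> mg g0 pg.
have mgs (b : R) : measurable_fun [set: measurableTypeR R] (fun x : R => g (x + b)).
  exact: (measurableT_comp mg (measurable_shift b)).
rewrite -integral_itv_bndo_bndc; last first. exact: (measurable_funTS (mgs a)).
rewrite -[RHS]integral_itv_bndo_bndc; last exact: (measurable_funTS mg).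
pose b := a - (Num.floor a)%:~R.
have b0 : 0 <= b by rewrite subr_ge0 floor_le.
have b1 : b < 1.
  by rewrite ltrBlDl; have /andP[_] := floor_itv a; rewrite intrD.
transitivity (\int[mu]_(x in `[0%R, 1%R[) g (x + b)%R)%E.
  apply: eq_integral => x _; rewrite -(pg (x + b) (Num.floor a)) /b.
  by rewrite addrA subrK.
transitivity (\int[mu]_(x in `[b, (1 + b)%R[) g x)%E.
  rewrite [RHS](ge0_integral_shift b)//; congr integral.
  apply/seteqP; split => x /=; rewrite !in_itv/= lerDr ltrD2r //.
rewrite (@itv_bndbnd_setU _ _ _ (BLeft 1)) ?bnd_simp ?(ltW b1) ?lerDl//.
rewrite ge0_integral_setU//; first last.
- apply/disj_setPS => x [] /=; rewrite !in_itv/= => /andP[_ x1] /andP[x1'].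
  by rewrite ltNge x1' in x1.
- exact: measurable_funTS.
rewrite [X in (_ + X)%E](ge0_integral_shift 1)//.
have -> : (fun x : R => x + 1) @^-1` `[1, (1 + b)%R[ = `[0, b[%classic.
  by apply/seteqP; split => x /=; rewrite !in_itv/= lerDr (addrC 1) ltrD2r.
under [X in (_ + X)%E]eq_integral do rewrite (pg _ 1).
rewrite [in RHS](@itv_bndbnd_setU _ _ _ (BLeft b)) ?bnd_simp ?(ltW b1)//.
rewrite ge0_integral_setU//; first by rewrite addeC.
- exact: measurable_funTS.
- apply/disj_setPS => x [] /=; rewrite !in_itv/= => /andP[_ x1] /andP[x1'].
  by rewrite ltNge x1' in x1.
Qed.

End lebesgue_shift.

Section torus_shift.
Context (R : realType).
Local Notation mu := (@lebesgue_measure R).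
Local Notation mR := (measurableTypeR R).

(** Tonelli for the first coordinate: the induction on the dimension goes through
    this formula. *)
Lemma ge0_integral_torusS d (f : d.+1.-tuple mR -> \bar R) :
  measurable_fun setT f -> (forall s, 0 <= f s)%E ->
  (\int[torus_prob R d.+1]_s f s =
   \int[mu]_(x in `[0%R, 1%R]) \int[torus_prob R d]_s f (tuple_cons (x, s)))%E.
Proof.
move=> mf f0 /=.
rewrite (@ge0_integral_distribution _ _ _ _ _ _ (@tuple_cons R d))//.
have mfc : measurable_fun setT (f \o @tuple_cons R d).
  exact: measurableT_comp mf (@measurable_tuple_cons R d).
rewrite (fubini_tonelli1 (f \o @tuple_cons R d))//; last first.
  by move=> z; exact: f0.
rewrite integral_uniform//.
- by rewrite subr0 invr1 mul1e.
- exact: (measurable_fun_fubini_tonelli_F (m2 := torus_prob R d) (f \o @tuple_cons R d) mfc (fun z => f0 _)).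
- by move=> x; apply: integral_ge0 => s _; exact: f0.
Qed.

(** Invariance under all of Z^d at once, expressed on tuples: this form restricts
    to the last d coordinates without mentioning unit vectors. *)
Definition lattice_periodic d T (f : d.-tuple mR -> T) :=
  forall s s', (forall i, exists z : int, tnth s' i = tnth s i + z%:~R) ->
  f s' = f s.

Definition tshift d (a : 'I_d -> R) (s : d.-tuple mR) : d.-tuple mR :=
  [tuple tnth s i + a i | i < d].

Lemma measurable_tshift d (a : 'I_d -> R) : measurable_fun setT (tshift a).
Proof.
apply/measurable_fun_tnthP => i.
have -> : (@tnth d mR ^~ i \o tshift a) = (fun s => tnth s i + a i).
  by apply/funext => s /=; rewrite tnth_mktuple.
exact: (measurableT_comp (measurable_shift (a i)) (measurable_tnth i)).
Qed.

(** The inner integral absorbs the shift of the last coordinates by induction; what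
    remains is a function of the first coordinate, periodic in one variable. *)
Lemma ge0_integral_torus_shift d (a : 'I_d -> R) (f : d.-tuple mR -> \bar R) :
  measurable_fun setT f -> (forall s, 0 <= f s)%E -> lattice_periodic f ->
  (\int[torus_prob R d]_s f (tshift a s) = \int[torus_prob R d]_s f s)%E.
Proof.
elim: d a f => [a f mf f0 pf|d IH a f mf f0 pf].
  by apply: eq_integral => s _; congr f; apply: eq_from_tnth => -[].
rewrite (ge0_integral_torusS mf f0).
rewrite (ge0_integral_torusS (f := fun s => f (tshift a s))
  (measurableT_comp mf (measurable_tshift a)) (fun s => f0 _)).
pose g (x : mR) := (\int[torus_prob R d]_s f (tuple_cons (x, s)))%E.
have mfc : measurable_fun setT (f \o @tuple_cons R d).
  exact: measurableT_comp mf (@measurable_tuple_cons R d).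
have mg : measurable_fun setT g.
  exact: (measurable_fun_fubini_tonelli_F (m2 := torus_prob R d) (f \o @tuple_cons R d) mfc (fun z => f0 _)).
transitivity (\int[mu]_(x in `[0%R, 1%R]) g (x + a ord0)%R)%E.
  apply: eq_integral => x _; rewrite /g.
  rewrite -(IH (fun i => a (lift ord0 i)) (fun s => f (tuple_cons ((x + a ord0)%R, s))))//.
  - apply: eq_integral => s _; congr f; apply: eq_from_tnth => i.
    rewrite tnth_mktuple.
    case: (unliftP ord0 i) => [j ->|->]; rewrite !(tnthS, tnth0)//=.
    by rewrite tnth_mktuple.
  - exact: (measurableT_comp mfc (measurable_pair1 (x + a ord0))).
  - move=> s s' ss'; apply: pf => i.
    case: (unliftP ord0 i) => [j ->|->]; rewrite !(tnthS, tnth0)//=.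
    by exists 0; rewrite addr0.
apply: ge0_integral_unit_shift => //.
  by move=> x; exact: integral_ge0.
move=> x z; apply: eq_integral => s _; apply: pf => i.
case: (unliftP ord0 i) => [j ->|->]; rewrite !(tnthS, tnth0)//=.
  by exists 0; rewrite addr0.
by exists z.
Qed.

End torus_shift.

(** * Periodic and continuous functions *)
Section torus_functions.
Context (R : realType).
Local Notation mR := (measurableTypeR R).

Lemma row_of_tshift d (a : 'rV[R]_d) s :
  row_of_tuple (tshift (a ord0) s) = row_of_tuple s + a.
Proof. by apply/rowP => i; rewrite !mxE tnth_mktuple. Qed.

Lemma periodic_unit_int d T (f : 'rV[R]_d -> T) i (z : int) x :
  torus_periodic f -> f (x + z%:~R *: unit_vec R i) = f x.
Proof.
move=> pf; elim/int_ind: z x => [|n IH|n IH] x.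
- by rewrite scale0r addr0.
- by rewrite intS intrD scalerDl scale1r addrA IH pf.
- rewrite -(pf (_ + _) i) intS opprD intrD scalerDl scaleN1r addrA.
  by rewrite [in LHS]addrAC subrK IH.
Qed.

Lemma periodic_int d T (f : 'rV[R]_d -> T) (z : 'I_d -> int) x :
  torus_periodic f -> f (x + \row_i (z i)%:~R) = f x.
Proof.
move=> pf.
have -> : \row_i (z i)%:~R = \sum_(i < d) (z i)%:~R *: unit_vec R i.
  rewrite [LHS]row_sum_delta; apply: eq_bigr => i _; by rewrite mxE.
elim: (index_enum _) x => [|i r IH] x; first by rewrite big_nil addr0.
by rewrite big_cons addrA IH periodic_unit_int.
Qed.

Lemma lattice_periodic_row d T (f : 'rV[R]_d -> T) :
  torus_periodic f -> lattice_periodic (f \o @row_of_tuple R d).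
Proof.
move=> pf s s' /choice[z zP] /=; rewrite -[RHS](periodic_int z _ pf).
by congr f; apply/rowP => i; rewrite !mxE zP.
Qed.

Lemma periodic_unit_cube d T (f : 'rV[R]_d -> T) x : torus_periodic f ->
  exists2 y, f y = f x & forall i, `[0, 1]%classic (y ord0 i).
Proof.
move=> pf; exists (x + \row_i (- Num.floor (x ord0 i))%:~R); first exact: periodic_int.
move=> i; rewrite !mxE /= in_itv/= intrN subr_ge0 floor_le/= lerBlDl.
by have /andP[_ /ltW] := floor_itv (x ord0 i); rewrite intrD.
Qed.

(** An open set is the union of the countably many rational cubes that it contains,
    and a cube is a finite intersection of conditions on single coordinates. *)
Lemma measurable_row_open d (U : set 'rV[R]_d) : open U ->
  measurable (@row_of_tuple R d @^-1` U).
Proof.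
move=> oU.
pose B (q : 'rV[rat]_d) (n : nat) : set 'rV[R]_d :=
  [set x | forall i, `|ratr (q ord0 i) - x ord0 i| < n.+1%:R^-1].
pose P q n := B q n `<=` U.
have -> : U = \bigcup_(q in [set: 'rV[rat]_d]) \bigcup_(n in P q) B q n.
  apply/seteqP; split => x; last by move=> [q _ [n /(_ x)]]; exact.
  move=> Ux; have /nbhs_ballP[e /= e0 eU] : nbhs x U by apply: open_nbhs_nbhs.
  have [n ne] : exists n : nat, n.+1%:R^-1 < e / 2.
    exists (Num.trunc (e / 2)^-1).
    rewrite invf_plt ?posrE ?divr_gt0 //; exact: truncnS_gt.
  have qP i : exists q : rat, `|ratr q - x ord0 i| < n.+1%:R^-1.
    have [|q] := @rat_in_itvoo R (x ord0 i - n.+1%:R^-1) (x ord0 i + n.+1%:R^-1).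
      by rewrite ltrBlDr -addrA ltrDl addr_gt0.
    rewrite in_itv/= => /andP[h1 h2]; exists q.
    by rewrite ltr_norml ltrBrDl h1/= ltrBlDl.
  have [q {}qP] := choice qP.
  exists (\row_i q i) => //; exists n.
    move=> y yq; apply: eU; split => // i j.
    rewrite (ord1 i) /ball/= (le_lt_trans (ler_distD (ratr (q j)) _ _))//.
    rewrite (splitr e) ltrD//; apply: lt_trans ne.
      by rewrite distrC.
    by have := yq j; rewrite mxE.
  by move=> i; rewrite mxE.
rewrite preimage_bigcup; apply: countable_bigcupT_measurable => // q.
rewrite preimage_bigcup; apply: bigcup_measurable => n _.
have -> : row_of_tuple (d:=d) @^-1` B q n = \bigcap_(i in [set: 'I_d])
    ((@tnth d mR)^~ i @^-1` (ball (ratr (q ord0 i) : R) (n.+1%:R^-1))).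
  by apply/seteqP; split => s h i; [move=> _|]; have := h i; rewrite /= mxE//; exact.
apply: fin_bigcap_measurable => // i _.
rewrite -[X in measurable X]setTI; apply: measurable_tnth => //.
exact: measurable_ball.
Qed.

Lemma measurable_row_continuous d (f : 'rV[R]_d -> R) : continuous f ->
  measurable_fun setT (f \o @row_of_tuple R d).
Proof.
move=> /continuousP cf mD.
apply: (measurability _ (RGenOInfty.measurableE R)) => // _ [_ [a ->] <-].
by rewrite setTI comp_preimage; apply: measurable_row_open; apply: cf.
Qed.
End torus_functions.

(** * Integration over the torus *)
Section torus_integral.
Context (R : realType) (d : nat).
Local Notation mR := (measurableTypeR R).
Implicit Types (f g : 'rV[R]_d -> R) (M a b : R).

Definition tcont f := torus_periodic f /\ continuous f.

(** Periodicity reduces the supremum over R^d to one over the compact set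
    [a, b] x [0, 1]^d. *)
Lemma periodic_family_bounded (F : R -> 'rV[R]_d -> R) a b :
  (forall s, a <= s <= b -> torus_periodic (F s)) ->
  (forall s x, a <= s <= b -> {for (s, x), continuous (fun z => F z.1 z.2)}) ->
  exists2 M, 0 <= M & forall s x, a <= s <= b -> `|F s x| <= M.
Proof.
move=> pF cF.
pose cube := [set v : 'rV[R]_d | forall i, `[0, 1]%classic (v ord0 i)].
have cc : compact (`[a, b]%classic `*` cube).
  apply: compact_setX; first exact: segment_compact.
  apply: (@rV_compact R d (fun=> `[0:R, 1:R]%classic)) => i; exact: segment_compact.
have cw : {within `[a, b]%classic `*` cube, continuous (fun z => F z.1 z.2)}.
  apply: continuous_in_subspaceT => -[s x]; rewrite inE => -[/= sab _].
  by apply: cF; rewrite in_itv/= in sab.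
have /compact_bounded[M [Mr MP]] := continuous_compact cw cc.
exists (`|M| + 1); first by rewrite addr_ge0.
move=> s x sab; have [y <- y01] := periodic_unit_cube x (pF s sab).
apply: (MP (`|M| + 1)); first by rewrite ltr_pwDr// ler_norm.
by exists (s, y) => //; split => //=; rewrite in_itv.
Qed.

Lemma tcont_bounded f : tcont f -> exists2 M, 0 <= M & forall x, `|f x| <= M.
Proof.
move=> [pf cf].
have [||M M0 MP] := @periodic_family_bounded (fun=> f) 0 0.
- by [].
- move=> s x _; apply: (@continuous_comp _ _ _ snd f); [exact: cvg_snd|exact: cf].
- by exists M => // x; apply: (MP 0); rewrite lexx.
Qed.

Lemma tcont_integrable f : tcont f -> torus_integrable f.
Proof.
move=> cf; have [M M0 fM] := tcont_bounded cf.
rewrite /torus_integrable.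
apply: (@measurable_bounded_integrable _ _ _ (torus_prob R d) (f \o @row_of_tuple R d)).
- exact: measurableT.
- by rewrite -[X in (X < _)%E]/(torus_prob R d setT) (@probability_setT _ _ R (torus_prob R d)) ltry.
- exact: measurable_row_continuous cf.2.
- by exists M; split; [exact: num_real|move=> x Mx y _ /=; rewrite (le_trans (fM _))// ltW].
Qed.

Lemma tcontD f g : tcont f -> tcont g -> tcont (fun x => f x + g x).
Proof.
move=> [pf cf] [pg cg]; split=> [x i|x]; first by rewrite pf pg.
exact: (cvgD (cf x) (cg x)).
Qed.

Lemma tcontN f : tcont f -> tcont (fun x => - f x).
Proof.
by move=> [pf cf]; split=> [x i|x]; [rewrite pf|exact: (cvgN (cf x))].
Qed.

Lemma tcontB f g : tcont f -> tcont g -> tcont (fun x => f x - g x).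
Proof. by move=> cf cg; exact: (tcontD cf (tcontN cg)). Qed.

Lemma tcontM f g : tcont f -> tcont g -> tcont (fun x => f x * g x).
Proof.
move=> [pf cf] [pg cg]; split=> [x i|x]; first by rewrite pf pg.
exact: (cvgM (cf x) (cg x)).
Qed.

Lemma tcont_cst a : tcont (fun=> a).
Proof. by split=> //; exact: cst_continuous. Qed.

Lemma tcont_sum (I : Type) (r : seq I) (F : I -> 'rV[R]_d -> R) :
  (forall i, tcont (F i)) -> tcont (fun x => \sum_(i <- r) F i x).
Proof.
move=> cF; elim: r => [|i r IH].
  under eq_fun do rewrite big_nil; exact: tcont_cst.
by under eq_fun do rewrite big_cons; exact: tcontD.
Qed.

Lemma eq_tint f g : (forall x, f x = g x) -> tint f = tint g.
Proof. by move=> fg; congr tint; apply/funext. Qed.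

Lemma tintD_int f g : torus_integrable f -> torus_integrable g ->
  tint (fun x => f x + g x) = tint f + tint g.
Proof. by move=> cf cg; rewrite /tint RintegralD. Qed.

Lemma tintB_int f g : torus_integrable f -> torus_integrable g ->
  tint (fun x => f x - g x) = tint f - tint g.
Proof. by move=> cf cg; rewrite /tint RintegralB. Qed.

Lemma tintD f g : tcont f -> tcont g -> tint (fun x => f x + g x) = tint f + tint g.
Proof. by move=> cf cg; apply: tintD_int; exact: tcont_integrable. Qed.

Lemma tintB f g : tcont f -> tcont g -> tint (fun x => f x - g x) = tint f - tint g.
Proof. by move=> cf cg; apply: tintB_int; exact: tcont_integrable. Qed.

Lemma tintZ a f : tcont f -> tint (fun x => a * f x) = a * tint f.
Proof. by move=> /tcont_integrable cf; rewrite /tint RintegralZl. Qed.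

Lemma torus_probT : torus_prob R d setT = 1%E.
Proof. exact: (@probability_setT _ _ R (torus_prob R d)). Qed.

Lemma tint_cst a : tint (fun _ : 'rV[R]_d => a) = a.
Proof. by rewrite /tint Rintegral_cst// [X in fine X]torus_probT mulr1. Qed.

Lemma tint_sum (I : Type) (r : seq I) (F : I -> 'rV[R]_d -> R) :
  (forall i, tcont (F i)) ->
  tint (fun x => \sum_(i <- r) F i x) = \sum_(i <- r) tint (F i).
Proof.
move=> cF; elim: r => [|i r IH].
  by under eq_fun do rewrite big_nil; rewrite big_nil tint_cst.
under eq_fun do rewrite big_cons.
by rewrite tintD ?IH ?big_cons//; exact: tcont_sum.
Qed.

Lemma le_norm_tint f (g : 'rV[R]_d -> R) :
  torus_integrable f -> torus_integrable g ->
  (forall x, `|f x| <= g x) -> `|tint f| <= tint g.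
Proof.
move=> cf cg fg; rewrite /tint; apply: le_trans (le_normr_Rintegral _ cf) _ => //.
apply: le_Rintegral => //; exact: (integrable_norm cf).
Qed.

(** Signed version of [ge0_integral_torus_shift], through positive and negative
    parts. *)
Lemma integral_torus_shift (a : 'rV[R]_d) f :
  torus_periodic f -> measurable_fun setT (f \o @row_of_tuple R d) ->
  (\int[torus_prob R d]_s (f (row_of_tuple s + a))%:E =
   \int[torus_prob R d]_s (f (row_of_tuple s))%:E)%E.
Proof.
move=> pf mf; pose F s := (f (row_of_tuple s))%:E.
have mF : measurable_fun setT F by exact/measurable_EFinP.
have pF : lattice_periodic F.
  by move=> s s' ss'; rewrite /F; congr EFin; exact: (lattice_periodic_row pf ss').
transitivity (\int[torus_prob R d]_s F (tshift (a ord0) s))%E.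
  by apply: eq_integral => s _; rewrite /F row_of_tshift.
rewrite [LHS]integralE [RHS]integralE; congr (_ - _)%E.
- have pFp : lattice_periodic (funepos F).
    by move=> s s' ss'; rewrite !funeposE (pF _ _ ss').
  rewrite -(ge0_integral_torus_shift (a ord0) (measurable_funepos mF) _ pFp)//.
  by apply: eq_integral => s _; rewrite !funeposE.
- have pFp : lattice_periodic (funeneg F).
    by move=> s s' ss'; rewrite !funenegE (pF _ _ ss').
  rewrite -(ge0_integral_torus_shift (a ord0) (measurable_funeneg mF) _ pFp)//.
  by apply: eq_integral => s _; rewrite !funenegE.
Qed.

Lemma tint_shift (a : 'rV[R]_d) f :
  torus_periodic f -> measurable_fun setT (f \o @row_of_tuple R d) ->
  tint (fun x => f (x + a)) = tint f.
Proof. by move=> pf mf; rewrite /tint /Rintegral integral_torus_shift. Qed.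

Lemma torus_integrable_shift (a : 'rV[R]_d) f :
  torus_periodic f -> torus_integrable f -> torus_integrable (fun x => f (x + a)).
Proof.
move=> pf /integrableP[/measurable_EFinP mf fi].
have mfa : measurable_fun setT (fun s => f (row_of_tuple s + a)).
  rewrite [X in measurable_fun _ X](_ : _ = (f \o @row_of_tuple R d) \o tshift (a ord0)).
    exact: (measurableT_comp mf (measurable_tshift (a ord0))).
  by apply/funext => s /=; rewrite row_of_tshift.
apply/integrableP; split; first exact/measurable_EFinP.
apply: le_lt_trans fi; rewrite le_eqVlt; apply/orP; left; apply/eqP.
rewrite (@integral_torus_shift a (fun x => `|f x|))//.
  by move=> x i; rewrite pf.
exact: measurableT_comp mf.
Qed.

End torus_integral.

(** * Convolution with a symmetric integrable kernel *)
Section torus_convolution.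
Context (R : realType) (d : nat).
Local Notation mR := (measurableTypeR R).
Implicit Types (r q : 'rV[R]_d -> R).
Variable K : 'rV[R]_d -> R.
Hypothesis pK : torus_periodic K.
Hypothesis iK : torus_integrable K.
Hypothesis sK : forall x, K (- x) = K x.

(** Symmetry turns the reflected kernel y |-> K (x - y) into a translate of K, to
    which translation invariance applies. *)
Lemma kernel_centered x y : K (x - y) = K (y + - x).
Proof. by rewrite -sK opprB. Qed.

Lemma kernel_mul_integrable r x : tcont r ->
  torus_integrable (fun y => K (x - y) * r y).
Proof.
move=> cr; have [M M0 rM] := tcont_bounded cr.
have -> : (fun y => K (x - y) * r y) = (fun y => K (y + - x) * r y).
  by apply/funext => y; rewrite kernel_centered.
have Kx := torus_integrable_shift (- x) pK iK.
have /integrableP[/measurable_EFinP mKx _] := Kx.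
have MKx := integrableZl (measurableT : measurable [set: d.-tuple mR]) M Kx.
apply: le_integrable MKx => //.
- apply/measurable_EFinP; apply: measurable_funM => //.
  exact: measurable_row_continuous cr.2.
- move=> s _ /=; rewrite lee_fin !normrM mulrC (ger0_norm M0).
  by rewrite ler_wpM2r.
Qed.

Lemma tconvB r q x : tcont r -> tcont q ->
  tconv K (fun y => r y - q y) x = tconv K r x - tconv K q x.
Proof.
move=> cr cq; rewrite /tconv -tintB_int; try exact: kernel_mul_integrable.
by apply: eq_tint => y; rewrite mulrBr.
Qed.

(** Young's inequality between L^1 and L^oo: every translate of K has the same
    L^1 norm. *)
Lemma tconv_bound r M x : tcont r -> (forall y, `|r y| <= M) ->
  `|tconv K r x| <= M * tint (fun y => `|K y|).
Proof.
move=> cr rM; have M0 : 0 <= M by apply: le_trans (rM 0).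
have iaK : torus_integrable (fun y => `|K y|) by exact: integrable_norm iK.
have paK : torus_periodic (fun y => `|K y|) by move=> y i; rewrite pK.
have /integrableP[/measurable_EFinP maK _] := iaK.
rewrite -(tint_shift (- x) paK maK).
have iaKx := torus_integrable_shift (- x) paK iaK.
rewrite -[leRHS]RintegralZl//.
apply: (@le_norm_tint _ _ (fun y => K (x - y) * r y) (fun y => M * `|K (y - x)|)).
- exact: kernel_mul_integrable.
- exact: (integrableZl (measurableT : measurable [set: d.-tuple mR]) M iaKx).
- by move=> y; rewrite normrM kernel_centered mulrC ler_wpM2r.
Qed.

End torus_convolution.

(** * Differentiation under the integral sign *)
Section leibniz.
Context (R : realType) (d : nat).
Implicit Types (F G : R -> 'rV[R]_d -> R).

(** On a compact interval around t the derivative G is bounded uniformly in x, by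
    periodicity, and a constant dominates on a probability space. *)
Lemma is_derive_tint F G (I : set R) (t : R) : open I -> I t ->
  (forall s, I s -> tcont (F s)) ->
  (forall s, I s -> torus_periodic (G s)) ->
  (forall s x, I s -> is_derive s 1 (fun s => F s x) (G s x)) ->
  (forall s x, I s -> {for (s, x), continuous (fun z => G z.1 z.2)}) ->
  is_derive t 1 (fun s => tint (F s)) (tint (G t)).
Proof.
move=> oI It cF pG dF cG.
have /nbhs_ballP[e /= e0 eI] : nbhs t I by exact: open_nbhs_nbhs.
have abI s : t - e / 2 <= s <= t + e / 2 -> I s.
  move=> /andP[h1 h2]; apply: eI; rewrite /ball/=.
  rewrite (@le_lt_trans _ _ (e / 2))// ?ltr_pdivrMr ?ltr_pMr ?ltr1n//.
  by rewrite distrC ler_distl h1.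
have [||M M0 MP] := @periodic_family_bounded _ _ G (t - e / 2) (t + e / 2).
- by move=> s /abI; exact: pG.
- by move=> s x /abI Is; exact: cG.
have ooI s : `]t - e / 2, t + e / 2[%classic s -> I s.
  by rewrite /= in_itv/= => /andP[/ltW h1 /ltW h2]; apply: abI; rewrite h1.
have tt : `]t - e / 2, t + e / 2[%classic t.
  by rewrite /= in_itv/= ltrBlDr !ltrDl divr_gt0.
pose f s y := F s (@row_of_tuple R d y).
have p1 s y : I s -> partial1of2 f s y = G s (row_of_tuple y).
  by move=> Is; rewrite partial1of2E; case: (dF s (row_of_tuple y) Is).
have hint s : `]t - e / 2, t + e / 2[%classic s ->
    (torus_prob R d).-integrable setT (EFin \o f s).
  by move=> /ooI Is; exact: (tcont_integrable (cF s Is)).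
have hder s y : `]t - e / 2, t + e / 2[%classic s ->
    [set: d.-tuple (measurableTypeR R)] y -> derivable (f^~ y) s 1.
  by move=> /ooI Is _; case: (dF s (row_of_tuple y) Is).
have hG : (torus_prob R d).-integrable setT (EFin \o cst M).
  exact: (tcont_integrable (tcont_cst d M)).
have hM s y : `]t - e / 2, t + e / 2[%classic s ->
    [set: d.-tuple (measurableTypeR R)] y -> `|partial1of2 f s y| <= cst M y.
  move=> sI _; rewrite p1; last exact: ooI.
  by apply: MP; move: sI; rewrite /= in_itv/= => /andP[/ltW-> /ltW->].
apply: DeriveDef.
  exact: (derivable_under_integral measurableT tt hint hder (fun=> M0) hG hM).
rewrite -derive1E.
rewrite (differentiation_under_integral measurableT tt hint hder (fun=> M0) hG hM).
by apply: eq_Rintegral => y _; rewrite p1.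
Qed.

End leibniz.

(** * Continuously differentiable functions *)
Section directional_rules.
Context (R : realType) (V : normedModType R).
Implicit Types (f g : V -> R) (v x : V).

Lemma dirD f g x v : differentiable f x -> differentiable g x ->
  'D_v (fun y => f y + g y) x = 'D_v f x + 'D_v g x.
Proof. by move=> df dg; rewrite (@deriveD _ _ _ f g)//; exact: diff_derivable. Qed.

Lemma dirN f x v : differentiable f x -> 'D_v (fun y => - f y) x = - 'D_v f x.
Proof. by move=> df; rewrite (@deriveN _ _ _ f)//; exact: diff_derivable. Qed.

Lemma dirB f g x v : differentiable f x -> differentiable g x ->
  'D_v (fun y => f y - g y) x = 'D_v f x - 'D_v g x.
Proof. by move=> df dg; rewrite (@deriveB _ _ _ f g)//; exact: diff_derivable. Qed.

Lemma dirM f g x v : differentiable f x -> differentiable g x ->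
  'D_v (fun y => f y * g y) x = f x * 'D_v g x + 'D_v f x * g x.
Proof.
move=> df dg; rewrite (@deriveM _ _ f g)//; try exact: diff_derivable.
by rewrite /GRing.scale/= (mulrC (g x)).
Qed.

Lemma dir_cst (a : R) x v : 'D_v (fun _ : V => a) x = 0.
Proof. exact: derive_cst. Qed.

Lemma dir_sum n (F : 'I_n -> V -> R) x v : (forall i, differentiable (F i) x) ->
  'D_v (fun y => \sum_(i < n) F i y) x = \sum_(i < n) 'D_v (F i) x.
Proof.
move=> dF; have -> : (fun y => \sum_(i < n) F i y) = \sum_(i < n) F i.
  by apply/funext => y; rewrite fct_sumE.
by rewrite derive_sum// => i; exact: diff_derivable.
Qed.

Lemma dir_comp (g : R -> R) f x v : differentiable f x -> differentiable g (f x) ->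
  'D_v (fun y => g (f y)) x = derive1 g (f x) * 'D_v f x.
Proof.
move=> df dg; have dgf : differentiable (g \o f) x by exact: differentiable_comp.
have E : 'd f x v = 'D_v f x *: (1 : R).
  by rewrite deriveE// /GRing.scale/= mulr1.
rewrite -[LHS]/('D_v (g \o f) x) (deriveE _ dgf) diff_comp//= E linearZ/=.
by rewrite derive1E (deriveE _ dg) mulrC.
Qed.

End directional_rules.

Section C1_functions.
Context (R : realType) (V : normedModType R) (U : set V).
Hypothesis oU : open U.
Implicit Types (f g : V -> R) (v x : V).

(** For open U.  The continuity of each directional derivative is asked separately,
    which is what the second level of [Ck_on] provides. *)
Definition C1_on f := (forall x, U x -> differentiable f x) /\
  (forall v x, U x -> {for x, continuous ('D_v f)}).

Lemma continuous_on_ext (f g : V -> R) x : U x -> (forall y, U y -> g y = f y) ->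
  {for x, continuous f} -> {for x, continuous g}.
Proof.
move=> Ux fg cf; rewrite /prop_for/continuous_at (fg x Ux).
apply: cvg_trans cf; apply: near_eq_cvg.
have := open_nbhs_nbhs (conj oU Ux); apply: filterS => y Uy.
by rewrite fg.
Qed.

Lemma C1_diff f x : C1_on f -> U x -> differentiable f x.
Proof. by move=> [df _]; exact: df. Qed.

Lemma C1_continuous f x : C1_on f -> U x -> {for x, continuous f}.
Proof. by move=> cf Ux; exact/differentiable_continuous/C1_diff. Qed.

Lemma C1_derive f v x : C1_on f -> U x -> {for x, continuous ('D_v f)}.
Proof. by move=> [_ cf]; exact: cf. Qed.

Lemma C1_cst a : C1_on (fun=> a).
Proof.
split=> [x _|v x Ux]; first exact: differentiable_cst.
apply: (@continuous_on_ext (fun=> 0)) => // [y _|].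
  by rewrite dir_cst.
exact: cst_continuous.
Qed.

Lemma C1D f g : C1_on f -> C1_on g -> C1_on (fun x => f x + g x).
Proof.
move=> cf cg; split=> [x Ux|v x Ux].
  by apply: (@differentiableD _ _ _ f g); exact: C1_diff.
apply: (@continuous_on_ext (fun x => 'D_v f x + 'D_v g x)) => // [y Uy|].
  by rewrite dirD//; exact: C1_diff.
by apply: cvgD; exact: C1_derive.
Qed.

Lemma C1N f : C1_on f -> C1_on (fun x => - f x).
Proof.
move=> cf; split=> [x Ux|v x Ux].
  by apply: (@differentiableN _ _ _ f); exact: C1_diff.
apply: (@continuous_on_ext (fun x => - 'D_v f x)) => // [y Uy|].
  by rewrite dirN//; exact: C1_diff.
by apply: cvgN; exact: C1_derive.
Qed.

Lemma C1B f g : C1_on f -> C1_on g -> C1_on (fun x => f x - g x).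
Proof. by move=> cf cg; exact: (C1D cf (C1N cg)). Qed.

Lemma C1M f g : C1_on f -> C1_on g -> C1_on (fun x => f x * g x).
Proof.
move=> cf cg; split=> [x Ux|v x Ux].
  by apply: (@differentiableM _ _ f g); exact: C1_diff.
apply: (@continuous_on_ext (fun x => f x * 'D_v g x + 'D_v f x * g x)) => // [y Uy|].
  by rewrite dirM//; exact: C1_diff.
by apply: cvgD; apply: cvgM; by [exact: C1_derive|exact: C1_continuous].
Qed.

Lemma C1_sum n (F : 'I_n -> V -> R) :
  (forall i, C1_on (F i)) -> C1_on (fun x => \sum_(i < n) F i x).
Proof.
move=> cF; elim: n F cF => [|n IH] F cF.
  by under eq_fun do rewrite big_ord0; exact: C1_cst.
by under eq_fun do rewrite big_ord_recl; apply: C1D => //; exact: IH.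
Qed.

Lemma C1_comp (P : set R) (g : R -> R) f : C1_on f ->
  (forall x, U x -> P (f x)) ->
  (forall r, P r -> differentiable g r) ->
  (forall r, P r -> {for r, continuous (derive1 g)}) ->
  C1_on (fun x => g (f x)).
Proof.
move=> cf fP dg cg; split=> [x Ux|v x Ux].
  by apply: differentiable_comp; [exact: C1_diff|exact/dg/fP].
apply: (@continuous_on_ext (fun x => derive1 g (f x) * 'D_v f x)) => // [y Uy|].
  by rewrite dir_comp//; [exact: C1_diff|exact/dg/fP].
apply: cvgM; last exact: C1_derive.
apply: (@continuous_comp _ _ _ f (derive1 g)); first exact: C1_continuous.
exact/cg/fP.
Qed.

End C1_functions.

(** * Symmetry of mixed directional derivatives *)
Section lines.
Context (R : realType) (V : normedModType R).
Implicit Types (f : V -> R) (v w x : V).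

Lemma derive_translate f v a x : 'D_v (fun y => f (y + a)) x = 'D_v f (x + a).
Proof.
suff E : (fun h : R => h^-1 *: (((fun y => f (y + a)) \o shift x) (h *: v) -
    f (x + a))) =
    (fun h : R => h^-1 *: ((f \o shift (x + a)) (h *: v) - f (x + a))).
  by rewrite /derive E.
by apply/funext => h /=; rewrite addrA.
Qed.

Lemma differentiable_translate f a x : differentiable f (x + a) ->
  differentiable (fun y => f (y + a)) x.
Proof.
move=> df.
have h1 : differentiable (fun y : V => y) x by exact: ex_diff.
have h2 : differentiable (cst a) x by exact: differentiable_cst.
have h3 := differentiableD h1 h2.
exact: (differentiable_comp h3 df).
Qed.

Lemma is_derive_line f v x (s : R) : differentiable f (x + s *: v) ->
  is_derive s 1 (fun s => f (x + s *: v)) ('D_v f (x + s *: v)).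
Proof.
move=> /(@diff_derivable _ _ _ _ _ v) df.
have E : (fun h : R => h^-1 *: (((fun s => f (x + s *: v)) \o shift s) (h *: 1) -
    f (x + s *: v))) =
  (fun h : R => h^-1 *: ((f \o shift (x + s *: v)) (h *: v) - f (x + s *: v))).
  apply/funext => h /=; congr (_ *: (f _ - _)).
  have -> : h *: (1 : R) = h by exact: mulr1.
  by rewrite /shift scalerDl addrCA.
by apply: DeriveDef; rewrite /derivable /derive E.
Qed.

Lemma dirMVT f v x (h : R) : 0 < h -> (forall y, differentiable f y) ->
  exists2 c, 0 < c < h & f (x + h *: v) - f x = 'D_v f (x + c *: v) * h.
Proof.
move=> h0 df.
have dl (s : R) : is_derive s 1 (fun s : R => f (x + s *: v)) ('D_v f (x + s *: v)).
  exact: is_derive_line.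
have [|c c0 E] := @MVT R (fun s => f (x + s *: v)) (fun s => 'D_v f (x + s *: v)) 0 h h0.
- by apply: derivable_within_continuous => s _; case: (dl s).
- by exists c; rewrite ?in_itv// in c0 *; move: E; rewrite scale0r addr0 subr0.
Qed.

(** The mean value theorem along v, applied to the increment
    y |-> f (y + h w) - f y, then along w, applied to 'D_v f. *)
Lemma second_difference f v w x (h : R) : 0 < h ->
  (forall y, differentiable f y) -> (forall y, differentiable ('D_v f) y) ->
  exists c d, [/\ 0 < c < h, 0 < d < h &
   f (x + h *: v + h *: w) - f (x + h *: v) - (f (x + h *: w) - f x) =
   'D_w ('D_v f) (x + c *: v + d *: w) * h * h].
Proof.
move=> h0 df ddf.
have dF y : differentiable (fun y => f (y + h *: w) - f y) y.
  by apply: differentiableB => //; exact: differentiable_translate.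
have [c c0 ->] := dirMVT v x h0 dF.
rewrite dirB//; last exact: differentiable_translate.
rewrite derive_translate.
have [e e0 ->] := dirMVT w (x + c *: v) h0 ddf.
by exists c, e.
Qed.

(** Schwarz's theorem: the second difference of f is symmetric in v and w, and after
    division by h^2 it is a value of either mixed derivative at a point that
    tends to x with h. *)
Lemma dir_commute f v w x : (forall y, differentiable f y) ->
  C1_on setT ('D_v f) -> C1_on setT ('D_w f) ->
  'D_v ('D_w f) x = 'D_w ('D_v f) x.
Proof.
move=> df cv cw; apply/eqP; rewrite -subr_eq0 -normr_le0.
apply/ler_addgt0Pl => e e0; rewrite addr0.
have := cv.2 w x I; move/cvgrPdist_lt/(_ (e / 2)).
rewrite divr_gt0// => /(_ isT)/nbhs_ballP[d1 /= d10 hd1].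
have := cw.2 v x I; move/cvgrPdist_lt/(_ (e / 2)).
rewrite divr_gt0// => /(_ isT)/nbhs_ballP[d2 /= d20 hd2].
(* For 0 < c, k < h the point x + c v + k w is at distance less than h m of x, and
   the summand 1 keeps m positive. *)
pose m := `|v| + `|w| + 1.
have m0 : 0 < m by rewrite ltr_wpDl// addr_ge0.
pose h := Num.min d1 d2 / m.
have h0 : 0 < h by rewrite divr_gt0// lt_min d10.
have near c k : 0 < c < h -> 0 < k < h -> `|c *: v + k *: w| < Num.min d1 d2.
  move=> /andP[c0 ch] /andP[k0 kh]; apply: le_lt_trans (ler_normD _ _) _.
  rewrite !normrZ (gtr0_norm c0) (gtr0_norm k0).
  have -> : Num.min d1 d2 = h * m by rewrite /h divfK// gt_eqF.
  rewrite (@le_lt_trans _ _ (h * (`|v| + `|w|)))//.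
    by rewrite mulrDr lerD// ler_wpM2r// ltW.
  by rewrite ltr_pM2l// ltrDl.
have [c [k [ch kh E1]]] := @second_difference f v w x h h0 df (fun y => cv.1 y I).
have [c' [k' [ch' kh' E2]]] := @second_difference f w v x h h0 df (fun y => cw.1 y I).
have E : 'D_w ('D_v f) (x + c *: v + k *: w) = 'D_v ('D_w f) (x + c' *: w + k' *: v).
  apply: (mulIf (lt0r_neq0 h0)); apply: (mulIf (lt0r_neq0 h0)).
  rewrite (addrAC x (h *: w)) in E2.
  apply: etrans (esym E1) _; apply: etrans _ E2.
  move: (f (x + h *: v + h *: w)) (f (x + h *: v)) (f (x + h *: w)) (f x).
  by move=> f11 f10 f01 f00; ring.
rewrite (splitr e).
rewrite -(subrKA ('D_v ('D_w f) (x + c' *: w + k' *: v))).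
apply: le_trans (ler_normD _ _) _; apply: lerD; apply/ltW.
  apply: hd2; rewrite -ball_normE/= -addrA opprD addNKr normrN addrC.
  by have := near _ _ kh' ch'; rewrite lt_min => /andP[].
rewrite -E distrC; apply: hd1; rewrite -ball_normE/= -addrA opprD addNKr normrN.
by have := near _ _ ch kh; rewrite lt_min => /andP[].
Qed.

End lines.

(** * Integration by parts on the torus *)
Section torus_C1.
Context (R : realType) (d : nat).
Implicit Types (f g : 'rV[R]_d -> R).

Definition tC1 f := torus_periodic f /\ C1_on setT f.

Lemma tC1_cont f : tC1 f -> tcont f.
Proof. by move=> [pf cf]; split=> // x; exact/differentiable_continuous/(cf.1 x I). Qed.

Lemma tC1_diff f x : tC1 f -> differentiable f x.
Proof. by move=> [_ cf]; exact: (cf.1 x I). Qed.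

Lemma tC1_partial i f : tC1 f -> tcont (partial i f).
Proof.
move=> [pf cf]; split=> [x j|x]; last exact: (cf.2 _ x I).
have E : (fun y => f (y + unit_vec R j)) = f by apply/funext => y; rewrite pf.
by have := derive_translate f (unit_vec R i) (unit_vec R j) x; rewrite E.
Qed.

Lemma tC1_cst a : tC1 (fun=> a).
Proof. by split=> //; apply: C1_cst; exact: openT. Qed.

Lemma tC1D f g : tC1 f -> tC1 g -> tC1 (fun x => f x + g x).
Proof.
move=> [pf cf] [pg cg]; split=> [x i|]; first by rewrite pf pg.
exact: (C1D openT cf cg).
Qed.

Lemma tC1N f : tC1 f -> tC1 (fun x => - f x).
Proof.
by move=> [pf cf]; split=> [x i|]; [rewrite pf|exact: (C1N openT cf)].
Qed.

Lemma tC1B f g : tC1 f -> tC1 g -> tC1 (fun x => f x - g x).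
Proof. by move=> cf cg; exact: (tC1D cf (tC1N cg)). Qed.

Lemma tC1M f g : tC1 f -> tC1 g -> tC1 (fun x => f x * g x).
Proof.
move=> [pf cf] [pg cg]; split=> [x i|]; first by rewrite pf pg.
exact: (C1M openT cf cg).
Qed.

Lemma tC1_sum n (F : 'I_n -> 'rV[R]_d -> R) :
  (forall i, tC1 (F i)) -> tC1 (fun x => \sum_(i < n) F i x).
Proof.
move=> cF; split=> [x j|].
  by apply: eq_bigr => i _; rewrite (cF i).1.
by apply: (C1_sum openT) => i; exact: (cF i).2.
Qed.

(** By translation invariance the integral of x |-> f (x + s e_i) is constant in s;
    its derivative at s = 0 is the integral of the partial derivative. *)
Lemma tint_partial i f : tC1 f -> tint (partial i f) = 0.
Proof.
move=> cf; have [pf cpf] := tC1_partial i cf.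
pose e := unit_vec R i.
have cline : continuous (fun z : R * 'rV[R]_d => z.2 + z.1 *: e).
  move=> z; apply: (@cvgD _ _ _ _ _ snd (fun z => z.1 *: e)).
    exact: cvg_snd.
  apply: cvgZr_tmp; exact: cvg_fst.
have := @is_derive_tint R d (fun s x => f (x + s *: e))
  (fun s x => partial i f (x + s *: e)) setT 0 openT I.
have -> : (fun s : R => tint (fun x => f (x + s *: e))) = cst (tint f).
  apply/funext => s; apply: tint_shift; first exact: cf.1.
  exact: measurable_row_continuous (tC1_cont cf).2.
case.
- move=> s _; split=> [x j|x]; first by rewrite addrAC cf.1.
  exact/differentiable_continuous/differentiable_translate/(tC1_diff _ cf).
- by move=> s _ x j; rewrite addrAC pf.
- by move=> s x _; apply: is_derive_line; exact: tC1_diff.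
- move=> s x _; apply: (@continuous_comp _ _ _ (fun z : R * 'rV[R]_d => z.2 + z.1 *: e)).
    exact: cline.
  exact: cpf.
move=> _; rewrite derive_cst => /esym <-; apply: eq_tint => x.
by rewrite scale0r addr0.
Qed.

Lemma tint_parts i f g : tC1 f -> tC1 g ->
  tint (fun x => f x * partial i g x) = - tint (fun x => partial i f x * g x).
Proof.
move=> cf cg; apply/eqP; rewrite -addr_eq0; apply/eqP.
rewrite -tintD; last 2 first.
- by apply: tcontM; [exact: tC1_cont|exact: tC1_partial].
- by apply: tcontM; [exact: tC1_partial|exact: tC1_cont].
rewrite -(tint_partial i (tC1M cf cg)); apply: eq_tint => x.
by rewrite /partial dirM//; exact: tC1_diff.
Qed.

End torus_C1.

(** * The elliptic problem *)
Section elliptic.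
Context (R : realType) (d : nat) (beta : R).
Implicit Types (a b A B : 'rV[R]_d -> R).

(** A is the potential of the source a.  The mean-zero normalization is included for
    every beta: for beta != 0 it follows by integrating the equation. *)
Record elliptic_pair a A : Prop := {
  pair_source : tcont a;
  pair_C1 : tC1 A;
  pair_C2 : forall i, tC1 (partial i A);
  pair_pde : elliptic_eq beta a A;
  pair_mean0 : tint A = 0 }.

Lemma smooth_C1 (V : normedModType R) (U : set V) (f : V -> R) :
  smooth_on U f -> C1_on U f.
Proof. by move=> /(_ 1)[df cf]; split. Qed.

Lemma smooth_derive (V : normedModType R) (U : set V) (f : V -> R) v :
  smooth_on U f -> smooth_on U ('D_v f).
Proof. by move=> sf k; have [_] := sf k.+1; exact. Qed.

Lemma tcont_lap A : (forall i, tC1 (partial i A)) -> tcont (lap A).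
Proof. by move=> cA; apply: tcont_sum => i; exact: tC1_partial. Qed.

Lemma tint_lap A : (forall i, tC1 (partial i A)) -> tint (lap A) = 0.
Proof.
move=> cA; rewrite /lap tint_sum; last by move=> i; exact: tC1_partial.
by rewrite big1// => i _; exact: tint_partial.
Qed.

Lemma elliptic_solution_pair a A : tcont a -> elliptic_solution beta a A ->
  elliptic_pair a A.
Proof.
move=> ca [pA sA eA nA].
have cA : tC1 A by split=> //; exact: smooth_C1.
have c2A i : tC1 (partial i A).
  by split; [exact: (tC1_partial i cA).1|exact/smooth_C1/smooth_derive].
split=> //.
have [bz|b0] := eqVneq beta 0; first exact: nA.
have cl : tcont (lap A) := tcont_lap c2A.
have kA : tcont A := tC1_cont cA.
have cbA : tcont (fun x => beta * A x) by apply: tcontM => //; exact: tcont_cst.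
have := eq_tint eA.
rewrite (tintB ca); last exact: tcont_cst.
rewrite tint_cst subrr (eq_tint (g := fun x => beta * A x - lap A x)); last first.
  by move=> x; rewrite addrC.
rewrite tintB// tintZ// tint_lap// subr0 => /eqP.
by rewrite mulf_eq0 (negPf b0) => /eqP.
Qed.

(** The weak form of the equation for A tested against B; the mean of a contributes
    nothing since B has mean zero. *)
Lemma elliptic_form a A b B : elliptic_pair a A -> elliptic_pair b B ->
  tint (fun x => a x * B x) =
  \sum_i tint (fun x => partial i A x * partial i B x) +
  beta * tint (fun x => A x * B x).
Proof.
move=> [ca cA c2A eA mA] [cb cB c2B eB mB].
have kA := tC1_cont cA; have kB := tC1_cont cB.
have k1 i : tcont (partial i A) by exact: tC1_partial.
have k2 i : tcont (partial i (partial i A)) := tC1_partial i (c2A i).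
have l1 i : tcont (partial i B) by exact: tC1_partial.
transitivity (tint (fun x => \sum_i (-1) * (partial i (partial i A) x * B x) +
   (beta * (A x * B x) + mean a * B x))).
  apply: eq_tint => x; rewrite -mulr_sumr -mulr_suml.
  by have /eqP := eA x; rewrite eq_sym subr_eq => /eqP ->; rewrite /lap; ring.
have tB : tcont (fun x => beta * (A x * B x)).
  by apply: tcontM; [exact: tcont_cst|exact: tcontM].
have tm : tcont (fun x => mean a * B x).
  by apply: tcontM; [exact: tcont_cst|].
have ts i : tcont (fun x => (-1) * (partial i (partial i A) x * B x)).
  by apply: tcontM; [exact: tcont_cst|exact: tcontM].
rewrite tintD; [|exact: tcont_sum|exact: tcontD].
rewrite tintD// tintZ; last exact: tcontM.
rewrite tintZ// mB mulr0 addr0; congr (_ + _).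
rewrite tint_sum//; apply: eq_bigr => i _.
rewrite tintZ; last exact: tcontM.
by rewrite (tint_parts i (c2A i) cB) mulN1r.
Qed.

(** The solution operator is self-adjoint, since its weak form is symmetric. *)
Lemma elliptic_symmetric a A b B : elliptic_pair a A -> elliptic_pair b B ->
  tint (fun x => a x * B x) = tint (fun x => b x * A x).
Proof.
move=> pa pb; rewrite (elliptic_form pa pb) (elliptic_form pb pa).
have E1 : tint (fun x => A x * B x) = tint (fun x => B x * A x).
  by apply: eq_tint => x; rewrite mulrC.
have E2 : \sum_i tint (fun x => partial i A x * partial i B x) =
    \sum_i tint (fun x => partial i B x * partial i A x).
  by apply: eq_bigr => i _; apply: eq_tint => x; rewrite mulrC.
exact: (congr2 +%R E2 (congr1 ( *%R beta) E1)).
Qed.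

End elliptic.

(** * Functions of time and position *)
Section joint_C1.
Context (R : realType) (d : nat) (I : set R).
Hypothesis oI : open I.
Implicit Types (F G : R -> 'rV[R]_d -> R).
Let U : set (R * 'rV[R]_d) := I `*` setT.

(** Joint C^1 regularity in (s, x) over I, with periodicity in x. *)
Definition jC1 F := (forall s, I s -> torus_periodic (F s)) /\
  C1_on U (fun z : R * 'rV[R]_d => F z.1 z.2).

(** The time derivative, as a directional derivative of the function of (s, x): the
    rules and the continuity results for 'D_v then apply to it. *)
Definition tder F (s : R) (x : 'rV[R]_d) : R :=
  'D_(1, 0) (fun z : R * 'rV[R]_d => F z.1 z.2) (s, x).

Lemma open_slab : open U.
Proof.
rewrite openE => -[s x] [/= Is _].
exists (I, setT); last by [].
by split; [exact: open_nbhs_nbhs|exact: filterT].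
Qed.

Lemma slice_map_differentiable (s : R) (x : 'rV[R]_d) :
  differentiable (fun y : 'rV[R]_d => (s, y)) x.
Proof.
have h1 : differentiable (cst s : 'rV[R]_d -> R) x by exact: differentiable_cst.
have h2 : differentiable (fun y : 'rV[R]_d => y) x by exact: ex_diff.
exact: (differentiable_pair h1 h2).
Qed.

Lemma slice_differentiable F s x :
  differentiable (fun z : R * 'rV[R]_d => F z.1 z.2) (s, x) ->
  differentiable (F s) x.
Proof.
by move=> dF; exact: (differentiable_comp (slice_map_differentiable s x) dF).
Qed.

Lemma slice_derive F s v x :
  'D_v (F s) x = 'D_(0, v) (fun z : R * 'rV[R]_d => F z.1 z.2) (s, x).
Proof.
suff E : (fun h : R => h^-1 *: ((F s \o shift x) (h *: v) - F s x)) =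
  (fun h : R => h^-1 *: (((fun z : R * 'rV[R]_d => F z.1 z.2) \o shift (s, x))
     (h *: (0, v)) - F s x)).
  by rewrite /derive E.
apply/funext => h /=; congr (_ *: (F _ _ - _)).
by rewrite /GRing.scale/= mulr0 add0r.
Qed.

Lemma is_derive_tder F s x :
  differentiable (fun z : R * 'rV[R]_d => F z.1 z.2) (s, x) ->
  is_derive s 1 (fun s => F s x) (tder F s x).
Proof.
move=> dF0.
have dF : derivable (fun z : R * 'rV[R]_d => F z.1 z.2) (s, x) (1, 0).
  exact: diff_derivable.
suff E : (fun h : R => h^-1 *: (((fun s => F s x) \o shift s) (h *: 1) - F s x)) =
  (fun h : R => h^-1 *: (((fun z : R * 'rV[R]_d => F z.1 z.2) \o shift (s, x))
     (h *: (1, 0)) - F s x)).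
  by apply: DeriveDef; rewrite /tder /derivable /derive E.
apply/funext => h /=; congr (_ *: (F _ _ - _)).
by rewrite scaler0 add0r.
Qed.

Lemma jC1_diff F s x : jC1 F -> I s ->
  differentiable (fun z : R * 'rV[R]_d => F z.1 z.2) (s, x).
Proof. by move=> [_ [dF _]] Is; apply: dF; split. Qed.

Lemma jC1_slice F s : jC1 F -> I s -> tC1 (F s).
Proof.
move=> jF Is; split; first exact: jF.1.
split=> [x _|v x _]; first exact/slice_differentiable/jC1_diff.
have E : 'D_v (F s) =
    (fun x => 'D_(0, v) (fun z : R * 'rV[R]_d => F z.1 z.2) (s, x)).
  by apply/funext => y; exact: slice_derive.
rewrite E; apply: (@continuous_comp _ _ _ (fun y => (s, y))
    ('D_(0, v) (fun z : R * 'rV[R]_d => F z.1 z.2))).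
  exact/differentiable_continuous/slice_map_differentiable.
by apply: (jF.2.2 _ (s, x)); split.
Qed.

Lemma jC1_is_derive F s x : jC1 F -> I s ->
  is_derive s 1 (fun s => F s x) (tder F s x).
Proof. by move=> jF Is; exact/is_derive_tder/jC1_diff. Qed.

Lemma tderE F s x : jC1 F -> I s -> tder F s x = derive1 (fun s => F s x) s.
Proof. by move=> jF Is; rewrite derive1E; case: (jC1_is_derive x jF Is). Qed.

Lemma jC1_tder_continuous F s x : jC1 F -> I s ->
  {for (s, x), continuous (fun z : R * 'rV[R]_d => tder F z.1 z.2)}.
Proof.
move=> jF Is; have -> : (fun z : R * 'rV[R]_d => tder F z.1 z.2) =
    'D_(1, 0) (fun z : R * 'rV[R]_d => F z.1 z.2).
  by apply/funext => -[].
by apply: (jF.2.2 _ (s, x)); split.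
Qed.

Lemma tder_cont F s : jC1 F -> I s -> tcont (tder F s).
Proof.
move=> jF Is; split=> [x i|x].
  rewrite !tderE// !derive1E; apply: near_eq_derive.
  have := open_nbhs_nbhs (conj oI Is); apply: filterS => q Iq.
  exact: jF.1.
apply: (@continuous_comp _ _ _ (fun y => (s, y))
    (fun z : R * 'rV[R]_d => tder F z.1 z.2)).
  exact/differentiable_continuous/slice_map_differentiable.
exact: jC1_tder_continuous.
Qed.

Lemma is_derive_tint_jC1 F t : jC1 F -> I t ->
  is_derive t 1 (fun s => tint (F s)) (tint (tder F t)).
Proof.
move=> jF It; apply: (is_derive_tint oI It).
- by move=> s Is; exact/tC1_cont/jC1_slice.
- by move=> s Is; exact: (tder_cont jF Is).1.
- by move=> s x Is; exact: jC1_is_derive.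
- by move=> s x Is; exact: jC1_tder_continuous.
Qed.

Lemma jC1_smooth F : (forall s, I s -> torus_periodic (F s)) ->
  smooth_on U (fun z : R * 'rV[R]_d => F z.1 z.2) -> jC1 F.
Proof. by move=> pF sF; split=> //; exact: smooth_C1. Qed.

Lemma smooth_slice F s : I s ->
  smooth_on U (fun z : R * 'rV[R]_d => F z.1 z.2) -> smooth_on setT (F s).
Proof.
move=> Is sF k; move: F sF; elim: k => [|k IH] F sF.
  move=> x _; apply/differentiable_continuous/slice_differentiable.
  by apply: (sF 1%N).1; split.
split=> [x _|v].
  by apply: slice_differentiable; apply: (sF 1%N).1; split.
have -> : 'D_v (F s) =
    (fun x => 'D_(0, v) (fun z : R * 'rV[R]_d => F z.1 z.2) (s, x)).
  by apply/funext => y; exact: slice_derive.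
apply: (IH (fun s x => 'D_(0, v) (fun z : R * 'rV[R]_d => F z.1 z.2) (s, x))).
rewrite [X in smooth_on _ X](_ : _ = 'D_(0, v) (fun z : R * 'rV[R]_d => F z.1 z.2)).
  exact: smooth_derive.
by apply/funext => -[].
Qed.

Lemma jC1_component (u : R -> 'rV[R]_d -> 'rV[R]_d) i :
  (forall s, I s -> torus_periodic (u s)) ->
  smooth_on U (fun z : R * 'rV[R]_d => u z.1 z.2) ->
  jC1 (fun s x => u s x 0 i).
Proof.
move=> pu su; split=> [s Is x j|]; first by rewrite pu.
have du z : U z -> differentiable (fun z : R * 'rV[R]_d => u z.1 z.2) z.
  exact: (su 1%N).1.
split=> [z Uz|v z Uz].
  exact: (differentiable_comp (du z Uz) (differentiable_coord (u z.1 z.2) 0 i)).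
apply: (continuous_on_ext open_slab
  (f := fun z => 'D_v (fun z : R * 'rV[R]_d => u z.1 z.2) z 0 i)) => // [y Uy|].
  by rewrite derive_mx ?mxE//; exact/diff_derivable/du.
apply: (@continuous_comp _ _ _ ('D_v (fun z : R * 'rV[R]_d => u z.1 z.2))
  (fun w : 'rV[R]_d => w 0 i)); last exact: coord_continuous.
exact: (su 1%N).2.
Qed.

End joint_C1.

Section joint_C1_rules.
Context (R : realType) (d : nat) (I : set R).
Hypothesis oI : open I.
Implicit Types (F G : R -> 'rV[R]_d -> R).

Lemma jC1D F G : jC1 I F -> jC1 I G -> jC1 I (fun s x => F s x + G s x).
Proof.
move=> [pF cF] [pG cG]; split=> [s Is x i|]; first by rewrite pF ?pG.
exact: (C1D (open_slab oI) cF cG).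
Qed.

Lemma jC1N F : jC1 I F -> jC1 I (fun s x => - F s x).
Proof.
move=> [pF cF]; split=> [s Is x i|]; first by rewrite pF.
exact: (C1N (open_slab oI) cF).
Qed.

Lemma jC1B F G : jC1 I F -> jC1 I G -> jC1 I (fun s x => F s x - G s x).
Proof. by move=> jF jG; exact: (jC1D jF (jC1N jG)). Qed.

Lemma jC1M F G : jC1 I F -> jC1 I G -> jC1 I (fun s x => F s x * G s x).
Proof.
move=> [pF cF] [pG cG]; split=> [s Is x i|]; first by rewrite pF ?pG.
exact: (C1M (open_slab oI) cF cG).
Qed.

Lemma jC1_cst a : jC1 I (fun (_ : R) (_ : 'rV[R]_d) => a).
Proof. by split=> //; exact: (C1_cst (open_slab oI)). Qed.

Lemma jC1_sum n (F : 'I_n -> R -> 'rV[R]_d -> R) :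
  (forall i, jC1 I (F i)) -> jC1 I (fun s x => \sum_(i < n) F i s x).
Proof.
move=> jF; split=> [s Is x j|].
  by apply: eq_bigr => i _; rewrite (jF i).1.
by apply: (C1_sum (open_slab oI)) => i; exact: (jF i).2.
Qed.

Lemma jC1_comp (P : set R) (g : R -> R) F : jC1 I F ->
  (forall s x, I s -> P (F s x)) -> (forall r, P r -> differentiable g r) ->
  (forall r, P r -> {for r, continuous (derive1 g)}) ->
  jC1 I (fun s x => g (F s x)).
Proof.
move=> [pF cF] FP dg cg; split=> [s Is x i|]; first by rewrite pF.
by apply: (C1_comp (open_slab oI) cF (P := P)) => // z [Iz _]; exact: FP.
Qed.

Lemma tderD F G s x : jC1 I F -> jC1 I G -> I s ->
  tder (fun s x => F s x + G s x) s x = tder F s x + tder G s x.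
Proof.
move=> jF jG Is; rewrite /tder dirD//.
  exact: (jC1_diff x jF Is).
exact: (jC1_diff x jG Is).
Qed.

Lemma tderB F G s x : jC1 I F -> jC1 I G -> I s ->
  tder (fun s x => F s x - G s x) s x = tder F s x - tder G s x.
Proof.
move=> jF jG Is; rewrite /tder dirB//.
  exact: (jC1_diff x jF Is).
exact: (jC1_diff x jG Is).
Qed.

Lemma tderM F G s x : jC1 I F -> jC1 I G -> I s ->
  tder (fun s x => F s x * G s x) s x = F s x * tder G s x + tder F s x * G s x.
Proof.
move=> jF jG Is; rewrite /tder dirM//.
  exact: (jC1_diff x jF Is).
exact: (jC1_diff x jG Is).
Qed.

Lemma tder_cst a s x : tder (fun (_ : R) (_ : 'rV[R]_d) => a) s x = 0.
Proof. by rewrite /tder dir_cst. Qed.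

Lemma tder_sum n (F : 'I_n -> R -> 'rV[R]_d -> R) s x :
  (forall i, jC1 I (F i)) -> I s ->
  tder (fun s x => \sum_(i < n) F i s x) s x = \sum_(i < n) tder (F i) s x.
Proof.
move=> jF Is; rewrite /tder dir_sum// => i; exact: (jC1_diff x (jF i) Is).
Qed.

Lemma tder_comp (g : R -> R) F s x : jC1 I F -> I s ->
  differentiable g (F s x) ->
  tder (fun s x => g (F s x)) s x = derive1 g (F s x) * tder F s x.
Proof.
move=> jF Is dg; rewrite /tder dir_comp//; exact: (jC1_diff x jF Is).
Qed.

(** Uniform in x: a periodic continuous time derivative is bounded near t. *)
Lemma jC1_lipschitz F t : jC1 I F -> I t ->
  exists2 M, 0 <= M & \forall s \near t, forall x, `|F s x - F t x| <= M * `|s - t|.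
Proof.
move=> jF It.
have /nbhs_ballP[e /= e0 eI] : nbhs t I by exact: open_nbhs_nbhs.
have abI s : t - e / 2 <= s <= t + e / 2 -> I s.
  move=> /andP[h1 h2]; apply: eI; rewrite /ball/=.
  rewrite (@le_lt_trans _ _ (e / 2))// ?ltr_pdivrMr ?ltr_pMr ?ltr1n//.
  by rewrite distrC ler_distl h1.
have [||M M0 MP] := @periodic_family_bounded _ _ (tder F) (t - e / 2) (t + e / 2).
- by move=> s /abI Is; exact: (tder_cont oI jF Is).1.
- by move=> s x /abI Is; exact: (jC1_tder_continuous (x := x) jF Is).
exists M => //.
have mvt a b x : t - e / 2 <= a -> b <= t + e / 2 -> a < b ->
    `|F b x - F a x| <= M * `|b - a|.
  move=> ea be ab.
  have dl (s : R) : a <= s <= b -> is_derive s 1 (fun s => F s x) (tder F s x).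
    move=> /andP[as_ sb]; apply: (jC1_is_derive x jF); apply: abI.
    by rewrite (le_trans ea as_) (le_trans sb be).
  have dl1 (s : R) : s \in `]a, b[ -> is_derive s 1 (fun s => F s x) (tder F s x).
    by rewrite in_itv/= => /andP[/ltW h1 /ltW h2]; apply: dl; rewrite h1.
  have cl : {within `[a, b], continuous (fun s => F s x)}.
    apply: derivable_within_continuous => s; rewrite in_itv/= => sab.
    by case: (dl s sab).
  have [c] := MVT ab dl1 cl.
  rewrite in_itv/= => /andP[/ltW ac /ltW cb] ->.
  rewrite normrM ler_wpM2r//; apply: MP.
  by rewrite (le_trans ea ac) (le_trans cb be).
near=> s => x.
have : `|t - s| < e / 2.
  by near: s; apply: (@nbhsx_ballx _ R^o t (e / 2)); rewrite divr_gt0.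
rewrite ltr_distlC => /andP[h1 h2].
have [st|ts|->] := ltgtP s t.
- by rewrite distrC (distrC s); apply: mvt => //; [exact: ltW|rewrite lerDl ltW// divr_gt0].
- by apply: mvt => //; [rewrite lerBlDr lerDl ltW// divr_gt0|exact: ltW].
- by rewrite !subrr !normr0 mulr0.
Unshelve. all: by end_near. Qed.

End joint_C1_rules.

(** * Time derivative of the interaction energy *)
Section interaction_energy.
Context (R : realType) (d : nat).

Lemma is_derive_quadratic_bound (f : R -> R) (t M : R) : f t = 0 -> 0 <= M ->
  (\forall s \near t, `|f s| <= M * `|s - t| ^+ 2) -> is_derive t 1 f 0.
Proof.
move=> ft M0 /nbhs_ballP[e /= e0 fM].
suff H : (fun h : R => h^-1 *: ((f \o shift t) (h *: 1) - f t)) @ 0^' --> (0 : R).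
  by apply: DeriveDef; [apply/cvg_ex; exists 0|exact/cvg_lim].
apply/cvgrPdist_le => /= eps eps0; near=> h.
have h0 : h != 0 by near: h; exact: nbhs_dnbhs_neq.
have hh : `|h| <= eps / (M + 1).
  by near: h; apply: dnbhs0_le; rewrite divr_gt0// ltr_wpDl.
have he : `|h| < e by near: h; exact: dnbhs0_lt.
rewrite sub0r normrN ft subr0.
have -> : h *: (1 : R) = h by exact: mulr1.
rewrite normrM normfV ler_pdivrMl ?normr_gt0//.
have := fM (h + t); rewrite /ball/= distrC addrK => /(_ he)/le_trans; apply.
rewrite expr2 mulrA (mulrC _ eps) ler_wpM2r//.
apply: (@le_trans _ _ ((M + 1) * `|h|)); first by rewrite ler_wpM2r// lerDl.
by rewrite mulrC -ler_pdivlMr// ltr_wpDl.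
Unshelve. all: by end_near. Qed.

Variables (beta : R) (K : 'rV[R]_d -> R).
Hypothesis pK : torus_periodic K.
Hypothesis iK : torus_integrable K.
Hypothesis sK : forall x, K (- x) = K x.

(** With N the interaction energy and G(s) = int r(s) C(t), the symmetry of the solution
    operator gives N(s) - 2 G(s) + N(t) = int (r(s) - r(t)) (C(s) - C(t)).  Both
    factors are O(s - t), the second one by [tconv_bound], so that N' = 2 G' at t. *)
Lemma is_derive_interaction (I : set R) (r : R -> 'rV[R]_d -> R) t :
  open I -> I t -> jC1 I r ->
  (forall s, I s -> elliptic_pair beta (r s) (tconv K (r s))) ->
  is_derive t 1 (fun s => tint (fun x => r s x * tconv K (r s) x))
    (2 * tint (fun x => tder r t x * tconv K (r t) x)).
Proof.
move=> oI It jr er; pose C s := tconv K (r s).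
have kr s : I s -> tcont (r s) by move=> Is; exact: pair_source (er s Is).
have kC s : I s -> tcont (C s) by move=> Is; exact: tC1_cont (pair_C1 (er s Is)).
pose N s := tint (fun x => r s x * C s x).
pose G s := tint (fun x => r s x * C t x).
have dG : is_derive t 1 G (tint (fun x => tder r t x * C t x)).
  have [pC cC] := kC t It.
  apply: (@is_derive_tint _ _ (fun s x => r s x * C t x)
    (fun s x => tder r s x * C t x) I t oI It).
  - by move=> s Is; apply: tcontM; [exact: kr|split].
  - by move=> s Is x i; rewrite (tder_cont oI jr Is).1 pC.
  - move=> s x Is; have [h1 h2] := jC1_is_derive x jr Is.
    apply: DeriveDef; first exact: (derivableM h1 (derivable_cst (C t x) s 1)).
    rewrite (deriveM h1 (derivable_cst (C t x) s 1)) derive_cst scaler0 add0r h2.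
    by rewrite /GRing.scale/= mulrC.
  - move=> s x Is; apply: cvgM; first exact: (jC1_tder_continuous (x := x) jr Is).
    apply: (@continuous_comp _ _ _ snd (C t)); [exact: cvg_snd|exact: cC].
(* Rm vanishes at t, and differs from N - 2 G by a constant. *)
pose Rm s := N s - 2 * G s + (2 * G t - N t).
have Rmt : Rm t = 0.
  by rewrite /Rm addrA subrK subrr.
have RmE s : I s -> Rm s = tint (fun x => (r s x - r t x) * (C s x - C t x)).
  move=> Is; have k1 := kr s Is; have k2 := kr t It; have k3 := kC s Is; have k4 := kC t It.
  have sym : tint (fun x => r t x * C s x) = G s.
    exact: (elliptic_symmetric (er t It) (er s Is)).
  transitivity (tint (fun x => r s x * C s x - r s x * C t x -
      (r t x * C s x - r t x * C t x))); last first.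
    by apply: eq_tint => x; move: (r s x) (r t x) (C s x) (C t x) => *; ring.
  rewrite tintB; [|by apply: tcontB; exact: tcontM..].
  rewrite tintB; [|exact: tcontM..].
  rewrite tintB; [|exact: tcontM..].
  rewrite sym -/(N s) -/(G s) -/(N t) /Rm.
  have -> : G t = N t by [].
  by move: (N s) (G s) (N t) => n1 g1 n2; ring.
have [M M0 MP] := jC1_lipschitz oI jr It.
have nI : \forall s \near t, I s := open_nbhs_nbhs (conj oI It).
pose k := tint (fun y => `|K y|).
have k0 : 0 <= k by apply: Rintegral_ge0.
have dRm : is_derive t 1 Rm 0.
  apply: (is_derive_quadratic_bound (M := M * (M * k)) Rmt).
    by rewrite !mulr_ge0.
  near=> s; have Is : I s by near: s.
  have sM x : `|r s x - r t x| <= M * `|s - t| by move: x; near: s.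
  rewrite RmE//.
  have kd : tcont (fun x => r s x - r t x) by apply: tcontB; exact: kr.
  have CM x : `|C s x - C t x| <= M * `|s - t| * k.
    rewrite /C -(tconvB pK iK sK x (kr s Is) (kr t It)).
    exact: (tconv_bound pK iK sK x kd sM).
  rewrite -[leRHS](tint_cst d); apply: le_norm_tint.
  - by apply/tcont_integrable/tcontM => //; apply: tcontB; exact: kC.
  - exact/tcont_integrable/tcont_cst.
  - move=> x; rewrite normrM.
    have -> : M * (M * k) * `|s - t| ^+ 2 = (M * `|s - t|) * (M * `|s - t| * k) by ring.
    by apply: ler_pM.
have -> : (fun s => tint (fun x => r s x * tconv K (r s) x)) =
    (fun s => Rm s + 2 * G s - (2 * G t - N t)).
  apply/funext => s; rewrite /Rm -/(N s); move: (N s) (G s) (N t) (G t) => *; ring.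
have [e1 e2] := dRm; have [g1 g2] := dG.
have d2 : is_derive t 1 (fun s => 2 * G s) (2 * tint (fun x => tder r t x * C t x)).
  have c2 : derivable (cst (2 : R)) t 1 by exact: derivable_cst.
  apply: DeriveDef; first exact: (derivableM c2 g1).
  by rewrite (deriveM c2 g1) derive_cst scaler0 addr0 g2.
have -> : 2 * tint (fun x => tder r t x * tconv K (r t) x) =
   0 + 2 * tint (fun x => tder r t x * C t x) - 0 by rewrite add0r subr0.
exact: (is_deriveB (is_deriveD dRm d2) (is_derive_cst (2 * G t - N t) t 1)).
Unshelve. all: by end_near. Qed.

End interaction_energy.

(** * Summation identities *)
Section algebra.
Context (R : realType) (d : nat).
Implicit Types (u v U g k : 'I_d -> R) (Du Dv DG : 'I_d -> 'I_d -> R).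

(** In index form U . (- (u . grad) u + (v . grad) v) + grad v : U (x) U =
    - U . (u . grad) U with U = u - v. *)
Lemma convection_sums u v Du Dv :
  (\sum_i (u i - v i) * (- (\sum_j u j * Du i j) + \sum_j v j * Dv i j)) +
  \sum_i \sum_j Dv i j * ((u i - v i) * (u j - v j)) =
  - \sum_i u i * \sum_j (u j - v j) * (Du j i - Dv j i).
Proof.
under [X in _ = - X]eq_bigr do rewrite mulr_sumr.
rewrite [X in _ = - X]exchange_big -sumrN -big_split/=; apply: eq_bigr => i _.
rewrite -sumrN -big_split/= mulr_sumr -big_split/= -sumrN.
by apply: eq_bigr => j _; ring.
Qed.

(** The work of the enthalpy difference a - b, where dp = r da and dq = s db.  The
    remainder is a multiple of v . ds because db = k ds. *)
Lemma pressure_sums (r s k : R) u v a b p q (ds : 'I_d -> R) :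
  (forall i, p i = r * a i) -> (forall i, q i = s * b i) ->
  (forall i, b i = k * ds i) ->
  r * (\sum_i (a i - b i) * u i) - r * (\sum_i (u i - v i) * (a i - b i)) -
  \sum_i v i * (p i - q i) = - ((r - s) * k * \sum_i ds i * v i).
Proof.
move=> hp hq hb; rewrite !mulr_sumr -!sumrN -!big_split/=.
by apply: eq_bigr => i _; rewrite hp hq hb; ring.
Qed.

(** The force exerted through the gradient g, against the difference of the two mass
    fluxes. *)
Lemma potential_sums (r s : R) u v g :
  r * (\sum_i (u i - v i) * g i) - \sum_i g i * (r * u i - s * v i) =
  - ((r - s) * \sum_i g i * v i).
Proof.
rewrite !mulr_sumr -!sumrN -!big_split/=.
by apply: eq_bigr => i _; ring.
Qed.

(** The two contributions of the Hessian DG of the potential, one from the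
    divergence of grad C (x) grad C and one from the gradient of |grad C|^2 / 2,
    cancel because DG is symmetric. *)
Lemma hessian_sums v g DG : (forall i j, DG i j = DG j i) ->
  \sum_i g i * \sum_j DG i j * v j = \sum_i v i * \sum_j g j * DG i j.
Proof.
move=> sG; under eq_bigr do rewrite mulr_sumr.
rewrite exchange_big/=; apply: eq_bigr => i _; rewrite mulr_sumr.
by apply: eq_bigr => j _; rewrite (sG j i); ring.
Qed.

Lemma stretching_sums g Dv :
  \sum_i g i * \sum_j g j * Dv j i = \sum_i \sum_j Dv i j * (g i * g j).
Proof.
under eq_bigr do rewrite mulr_sumr.
by rewrite exchange_big; apply: eq_bigr => i _; apply: eq_bigr => j _; ring.
Qed.

End algebra.

(** * The pointwise balance of relative energy *)
Section partial_rules.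
Context (R : realType) (d : nat).
Implicit Types (f g : 'rV[R]_d -> R).

Lemma partialD i f g x : tC1 f -> tC1 g ->
  partial i (fun y => f y + g y) x = partial i f x + partial i g x.
Proof. by move=> cf cg; rewrite /partial dirD//; exact: tC1_diff. Qed.

Lemma partialN i f x : tC1 f -> partial i (fun y => - f y) x = - partial i f x.
Proof. by move=> cf; rewrite /partial dirN//; exact: tC1_diff. Qed.

Lemma partialB i f g x : tC1 f -> tC1 g ->
  partial i (fun y => f y - g y) x = partial i f x - partial i g x.
Proof. by move=> cf cg; rewrite /partial dirB//; exact: tC1_diff. Qed.

Lemma partialM i f g x : tC1 f -> tC1 g ->
  partial i (fun y => f y * g y) x = f x * partial i g x + partial i f x * g x.
Proof. by move=> cf cg; rewrite /partial dirM//; exact: tC1_diff. Qed.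

Lemma partial_cst i (a : R) (x : 'rV[R]_d) : partial i (fun=> a) x = 0.
Proof. exact: dir_cst. Qed.

Lemma partialZ i (a : R) f x : tC1 f ->
  partial i (fun y => a * f y) x = a * partial i f x.
Proof.
move=> cf; rewrite partialM//; last exact: tC1_cst.
by rewrite partial_cst mul0r addr0.
Qed.

Lemma partial_sum i n (F : 'I_n -> 'rV[R]_d -> R) x : (forall k, tC1 (F k)) ->
  partial i (fun y => \sum_(k < n) F k y) x = \sum_(k < n) partial i (F k) x.
Proof. by move=> cF; rewrite /partial dir_sum// => k; exact: tC1_diff. Qed.

Lemma partial_sqr i f x : tC1 f ->
  partial i (fun y => f y * f y) x = 2 * (f x * partial i f x).
Proof. by move=> cf; rewrite (partialM i x cf cf) mulrC -mulr2n mulr_natl. Qed.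

Lemma tint_divergence (F : 'I_d -> 'rV[R]_d -> R) : (forall i, tC1 (F i)) ->
  tint (fun x => \sum_i partial i (F i) x) = 0.
Proof.
move=> cF; rewrite tint_sum; last by move=> i; exact: tC1_partial.
by rewrite big1// => i _; exact: tint_partial.
Qed.

End partial_rules.

Section flux_sums.
Context (R : realType) (d : nat).

(** The shape in which [divergence_entropy_flux] presents each component. *)
Lemma split_flux_sum (A P Q X D B Y V E Z L F : 'I_d -> R)
    (e r ab pq c g G w n : R) :
  \sum_i (- (e * A i + r * P i) - (ab * A i + r * Q i) + (X i + D i * pq)
    + (c * (A i - B i) + Y i) - (g * V i + D i * G) + (E i + Z i + L i * w)
    - (F i + D i * n)) =
  - (e * \sum_i A i + r * \sum_i P i) - (ab * \sum_i A i + r * \sum_i Q i)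
    + (\sum_i X i + (\sum_i D i) * pq)
    + (c * (\sum_i A i - \sum_i B i) + \sum_i Y i)
    - (g * \sum_i V i + (\sum_i D i) * G)
    + (\sum_i E i + \sum_i Z i + (\sum_i L i) * w)
    - (\sum_i F i + (\sum_i D i) * n).
Proof.
elim: (index_enum _) => [|i s IH]; first by rewrite !big_nil; ring.
by rewrite !big_cons IH; ring.
Qed.

(** The pointwise balance once every sum over components has been named: A and B are
    the divergences of the mass fluxes, D that of v, L the Laplacian of the
    potential, V its derivative along v, Z and W the two contractions with the
    gradient of v.  The sums P, Q2, Q3 and L are eliminated by means of the
    hypotheses. *)
Lemma assemble_flux (A B P Q1 Q2 Q3 D V E Z L F S N B1 B2 Conv W Vs : R)
    (rho sigma ab pq c beta m k : R) :
  Conv + W = - P -> rho * Q1 - rho * B1 - Q2 = - ((rho - sigma) * k * Vs) ->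
  rho * B2 - Q3 = - ((rho - sigma) * V) -> E = F ->
  - L + beta * c = rho - sigma - m -> B = sigma * D + Vs ->
  ab * - A - k * - B * (rho - sigma) + 2^-1 * (- A * S)
    + rho * (Conv - B1 + B2) - (- A - - B) * c
    - (D * (- (pq - sigma * k * (rho - sigma)) + 2^-1 * N + beta / 2 * c ^+ 2 + m * c)
       - Z - rho * W) =
  - (2^-1 * S * A + rho * P) - (ab * A + rho * Q1) + (Q2 + D * pq)
    + (c * (A - B) + Q3) - ((beta * c + m) * V + D * (beta / 2 * (c * c) + m * c))
    + (E + Z + L * V) - (F + D * (2^-1 * N)).
Proof.
move=> hP hQ2 hQ3 -> hL ->.
have -> : P = - (Conv + W) by rewrite hP opprK.
have -> : Q2 = rho * Q1 - rho * B1 + (rho - sigma) * k * Vs.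
  by rewrite -[in RHS](opprK (_ * Vs)) -hQ2; ring.
have -> : Q3 = rho * B2 + (rho - sigma) * V.
  by rewrite -[in RHS](opprK (_ * V)) -hQ3; ring.
have -> : L = beta * c - (rho - sigma) + m.
  by rewrite -[LHS]opprK -[- L](addrK (beta * c)) hL; ring.
by field.
Qed.

End flux_sums.

Section static_identity.
Context (R : realType) (d : nat) (beta m : R).
Variables (rho sigma a b p q k C rt st : 'rV[R]_d -> R).
Variables (u v ut vt : 'I_d -> 'rV[R]_d -> R).
Hypotheses (crho : tC1 rho) (csigma : tC1 sigma) (ca : tC1 a) (cb : tC1 b)
  (cp : tC1 p) (cq : tC1 q) (cC : tC1 C) (cDC : forall i, tC1 (partial i C))
  (cu : forall i, tC1 (u i)) (cv : forall i, tC1 (v i)).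
Hypothesis enthalpy : forall i x, partial i p x = rho x * partial i a x.
Hypothesis enthalpyb : forall i x, partial i q x = sigma x * partial i b x.
Hypothesis enthalpy_chain : forall i x, partial i b x = k x * partial i sigma x.
Hypothesis hessian : forall i j x,
  partial i (partial j C) x = partial j (partial i C) x.
Hypothesis poisson : forall x, - lap C x + beta * C x = (rho x - sigma x) - m.
Hypothesis mass : forall x, rt x = - \sum_i partial i (fun y => rho y * u i y) x.
Hypothesis massb : forall x, st x = - \sum_i partial i (fun y => sigma y * v i y) x.
Hypothesis momentum : forall i x, ut i x - vt i x =
  - (\sum_j u j x * partial j (u i) x) + (\sum_j v j x * partial j (v i) x)
  - (partial i a x - partial i b x) + partial i C x.

Let half_sq x := 2^-1 * \sum_j ((u j x - v j x) * (u j x - v j x)).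
Let half_grad x := 2^-1 * \sum_j (partial j C x * partial j C x).
Let G x := beta / 2 * (C x * C x) + m * C x.

(** In order: transport of the kinetic energy, work of the enthalpy difference,
    work of the pressure difference along v, transport of the potential by the
    difference of the mass fluxes, and three terms that rewrite
    - (rho - sigma) v . grad C as a divergence, up to terms of the right-hand
    side: the gradient of
    G = beta C^2 / 2 + m C and the two parts of the stress tensor of C. *)
Definition entropy_flux (i : 'I_d) (x : 'rV[R]_d) : R :=
  - (half_sq x * (rho x * u i x))
  + - ((a x - b x) * (rho x * u i x))
  + v i x * (p x - q x)
  + C x * (rho x * u i x - sigma x * v i x)
  + - (v i x * G x)
  + partial i C x * (\sum_j partial j C x * v j x)
  + - (v i x * half_grad x).

Let cU j : tC1 (fun x => u j x - v j x). Proof. exact: (tC1B (cu j) (cv j)). Qed.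
Let cU2 j : tC1 (fun x => (u j x - v j x) * (u j x - v j x)).
Proof. exact: (tC1M (cU j) (cU j)). Qed.
Let cSU : tC1 (fun x => \sum_j (u j x - v j x) * (u j x - v j x)).
Proof. exact: (tC1_sum cU2). Qed.
Let c_half_sq : tC1 half_sq.
Proof. exact: (tC1M (tC1_cst d 2^-1) cSU). Qed.

Let cN2 j : tC1 (fun x => partial j C x * partial j C x).
Proof. exact: (tC1M (cDC j) (cDC j)). Qed.
Let cSN : tC1 (fun x => \sum_j partial j C x * partial j C x).
Proof. exact: (tC1_sum cN2). Qed.
Let c_half_grad : tC1 half_grad.
Proof. exact: (tC1M (tC1_cst d 2^-1) cSN). Qed.

Let cCC : tC1 (fun x => C x * C x). Proof. exact: (tC1M cC cC). Qed.
Let cG1 : tC1 (fun x => beta / 2 * (C x * C x)).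
Proof. exact: (tC1M (tC1_cst d (beta / 2)) cCC). Qed.
Let cG2 : tC1 (fun x => m * C x).
Proof. exact: (tC1M (tC1_cst d m) cC). Qed.
Let cG : tC1 G. Proof. exact: (tC1D cG1 cG2). Qed.

Let c_ru i : tC1 (fun x => rho x * u i x). Proof. exact: (tC1M crho (cu i)). Qed.
Let c_sv i : tC1 (fun x => sigma x * v i x). Proof. exact: (tC1M csigma (cv i)). Qed.
Let c_Cv j : tC1 (fun x => partial j C x * v j x).
Proof. exact: (tC1M (cDC j) (cv j)). Qed.
Let c_V : tC1 (fun x => \sum_j partial j C x * v j x).
Proof. exact: (tC1_sum c_Cv). Qed.

Let c1 i : tC1 (fun x => half_sq x * (rho x * u i x)).
Proof. exact: (tC1M c_half_sq (c_ru i)). Qed.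
Let c2 i : tC1 (fun x => (a x - b x) * (rho x * u i x)).
Proof. exact: (tC1M (tC1B ca cb) (c_ru i)). Qed.
Let c3 i : tC1 (fun x => v i x * (p x - q x)).
Proof. exact: (tC1M (cv i) (tC1B cp cq)). Qed.
Let c4 i : tC1 (fun x => C x * (rho x * u i x - sigma x * v i x)).
Proof. exact: (tC1M cC (tC1B (c_ru i) (c_sv i))). Qed.
Let c5 i : tC1 (fun x => v i x * G x). Proof. exact: (tC1M (cv i) cG). Qed.
Let c6 i : tC1 (fun x => partial i C x * (\sum_j partial j C x * v j x)).
Proof. exact: (tC1M (cDC i) c_V). Qed.
Let c7 i : tC1 (fun x => v i x * half_grad x).
Proof. exact: (tC1M (cv i) c_half_grad). Qed.

Lemma tC1_entropy_flux i : tC1 (entropy_flux i).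
Proof.
have e1 := tC1D (tC1N (c1 i)) (tC1N (c2 i)).
have e2 := tC1D e1 (c3 i); have e3 := tC1D e2 (c4 i).
have e4 := tC1D e3 (tC1N (c5 i)); have e5 := tC1D e4 (c6 i).
exact: (tC1D e5 (tC1N (c7 i))).
Qed.

Let d_half_sq i x : partial i half_sq x =
  \sum_j (u j x - v j x) * (partial i (u j) x - partial i (v j) x).
Proof.
rewrite (partialZ i 2^-1 x cSU) (partial_sum i x cU2) mulr_sumr.
apply: eq_bigr => j _.
rewrite (partial_sqr i x (cU j)) (partialB i x (cu j) (cv j)).
by rewrite mulKf// pnatr_eq0.
Qed.

Let d_half_grad i x : partial i half_grad x =
  \sum_j partial j C x * partial i (partial j C) x.
Proof.
rewrite (partialZ i 2^-1 x cSN) (partial_sum i x cN2) mulr_sumr.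
apply: eq_bigr => j _.
by rewrite (partial_sqr i x (cDC j)) mulKf// pnatr_eq0.
Qed.

Let d_G i x : partial i G x = (beta * C x + m) * partial i C x.
Proof.
rewrite (partialD i x cG1 cG2) (partialZ i (beta / 2) x cCC) (partialZ i m x cC).
by rewrite (partial_sqr i x cC); field.
Qed.

Lemma divergence_entropy_flux i x : partial i (entropy_flux i) x =
  - (half_sq x * partial i (fun y => rho y * u i y) x
     + rho x * (u i x * \sum_j (u j x - v j x) * (partial i (u j) x - partial i (v j) x)))
  - ((a x - b x) * partial i (fun y => rho y * u i y) x
     + rho x * ((partial i a x - partial i b x) * u i x))
  + (v i x * (partial i p x - partial i q x) + partial i (v i) x * (p x - q x))
  + (C x * (partial i (fun y => rho y * u i y) x - partial i (fun y => sigma y * v i y) x)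
     + partial i C x * (rho x * u i x - sigma x * v i x))
  - ((beta * C x + m) * (partial i C x * v i x) + partial i (v i) x * G x)
  + (partial i C x * (\sum_j partial i (partial j C) x * v j x)
     + partial i C x * (\sum_j partial j C x * partial i (v j) x)
     + partial i (partial i C) x * (\sum_j partial j C x * v j x))
  - (v i x * (\sum_j partial j C x * partial i (partial j C) x)
     + partial i (v i) x * half_grad x).
Proof.
have n1 := tC1N (c1 i); have n2 := tC1N (c2 i); have n5 := tC1N (c5 i).
have n7 := tC1N (c7 i).
have e1 := tC1D n1 n2; have e2 := tC1D e1 (c3 i); have e3 := tC1D e2 (c4 i).
have e4 := tC1D e3 n5; have e5 := tC1D e4 (c6 i).
rewrite /entropy_flux (partialD i x e5 n7) (partialD i x e4 (c6 i)).
rewrite (partialD i x e3 n5) (partialD i x e2 (c4 i)) (partialD i x e1 (c3 i)).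
rewrite (partialD i x n1 n2) (partialN i x (c1 i)) (partialN i x (c2 i)).
rewrite (partialN i x (c5 i)) (partialN i x (c7 i)).
rewrite (partialM i x c_half_sq (c_ru i)) d_half_sq.
rewrite (partialM i x (tC1B ca cb) (c_ru i)) (partialB i x ca cb).
rewrite (partialM i x (cv i) (tC1B cp cq)) (partialB i x cp cq).
rewrite (partialM i x cC (tC1B (c_ru i) (c_sv i))) (partialB i x (c_ru i) (c_sv i)).
rewrite (partialM i x (cv i) cG) d_G.
rewrite (partialM i x (cv i) c_half_grad) d_half_grad.
rewrite (partialM i x (cDC i) c_V) (partial_sum i x c_Cv).
have -> : \sum_j partial i (fun y => partial j C y * v j y) x =
  (\sum_j partial i (partial j C) x * v j x) + \sum_j partial j C x * partial i (v j) x.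
  rewrite -big_split/=; apply: eq_bigr => j _.
  by rewrite (partialM i x (cDC j) (cv j)) addrC.
move: (partial i (fun y => rho y * u i y) x) (partial i (fun y => sigma y * v i y) x)
  (half_sq x) (half_grad x) (G x) (\sum_j _) (\sum_j _) (\sum_j _) (\sum_j _) (\sum_j _) => *.
by ring.
Qed.

Lemma relative_energy_pointwise x :
  (a x - b x) * rt x - k x * st x * (rho x - sigma x)
    + 2^-1 * (rt x * \sum_j (u j x - v j x) * (u j x - v j x))
    + rho x * (\sum_i (u i x - v i x) * (ut i x - vt i x))
    - (rt x - st x) * C x
    - ((\sum_i partial i (v i) x) *
         (- (p x - q x - sigma x * k x * (rho x - sigma x))
          + 2^-1 * \sum_j (partial j C x * partial j C x)
          + beta / 2 * C x ^+ 2 + m * C x)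
       - \sum_i \sum_j partial j (v i) x * (partial i C x * partial j C x)
       - rho x * (\sum_i \sum_j partial j (v i) x *
           ((u i x - v i x) * (u j x - v j x)))) =
  \sum_i partial i (entropy_flux i) x.
Proof.
under [RHS]eq_bigr do rewrite divergence_entropy_flux.
rewrite split_flux_sum.
pose Conv := \sum_i (u i x - v i x) * (- (\sum_j u j x * partial j (u i) x)
  + \sum_j v j x * partial j (v i) x).
have -> : \sum_i (u i x - v i x) * (ut i x - vt i x) =
    Conv - (\sum_i (u i x - v i x) * (partial i a x - partial i b x))
    + \sum_i (u i x - v i x) * partial i C x.
  rewrite /Conv -sumrB -big_split/=; apply: eq_bigr => i _; rewrite momentum.
  by move: (\sum_j _) (\sum_j _) => S1 S2; ring.
rewrite mass massb -(stretching_sums (fun i => partial i C x)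
  (fun i j => partial j (v i) x)).
apply: assemble_flux.
- exact: (convection_sums (fun i => u i x) (fun i => v i x)
    (fun i j => partial j (u i) x) (fun i j => partial j (v i) x)).
- exact: (pressure_sums (fun i => u i x) (fun i => v i x)
    (fun i => enthalpy i x) (fun i => enthalpyb i x) (fun i => enthalpy_chain i x)).
- exact: (potential_sums (rho x) (sigma x) (fun i => u i x) (fun i => v i x)
    (fun i => partial i C x)).
- exact: (hessian_sums (fun i => v i x) (fun i => partial i C x)
    (fun i j => hessian i j x)).
- exact: poisson.
- rewrite mulr_sumr -big_split/=; apply: eq_bigr => i _.
  exact: (partialM i x csigma (cv i)).
Qed.

End static_identity.

(** * Consequences of the Euler-Poisson equations *)
Section internal_energy.
Context (R : realType) (h : R -> R).
Let P : set R := [set r | 0 < r].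
Hypothesis hh : smooth_on P h.

Lemma open_pos : open P. Proof. exact: open_gt. Qed.

Lemma C1_id : C1_on P (fun r : R => r).
Proof.
split=> [r _|v r Pr]; first exact: ex_diff.
apply: (continuous_on_ext open_pos (f := fun=> v)) => // [y _|].
  exact: derive_id.
exact: cst_continuous.
Qed.

Lemma derive1_fun (V : normedModType R) (f : R -> V) : derive1 f = 'D_1 f.
Proof. by apply/funext => r; rewrite derive1E. Qed.

Lemma C1_h : C1_on P h. Proof. exact: smooth_C1. Qed.

Lemma C1_dh : C1_on P (derive1 h).
Proof. by rewrite derive1_fun; exact/smooth_C1/smooth_derive. Qed.

Lemma C1_pressure : C1_on P (pressure h).
Proof. exact: (C1B open_pos (C1M open_pos C1_id C1_dh) C1_h). Qed.

(** The identity p'(r) = r h''(r) behind grad p(rho) = rho grad h'(rho). *)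
Lemma derive1_pressure r : 0 < r ->
  derive1 (pressure h) r = r * derive1 (derive1 h) r.
Proof.
move=> r0; rewrite derive1_fun.
have d1 : differentiable (fun r : R => r) r by exact: (C1_id.1 r r0).
have d2 : differentiable (derive1 h) r by exact: (C1_dh.1 r r0).
have d3 : differentiable h r by exact: (C1_h.1 r r0).
have d4 : differentiable (fun r : R => r * derive1 h r) r by exact: differentiableM.
rewrite /pressure (dirB (1 : R) d4 d3) (dirM (1 : R) d1 d2) derive_id mul1r.
by rewrite !derive1_fun addrK.
Qed.

Lemma C1_derive1_continuous (g : R -> R) : C1_on P g ->
  forall r, P r -> {for r, continuous (derive1 g)}.
Proof. by move=> [_ cg] r Pr; rewrite derive1_fun; exact: cg. Qed.

Lemma jC1_of_density d (I : set R) (g : R -> R) (rho : R -> 'rV[R]_d -> R) :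
  open I -> C1_on P g -> jC1 I rho -> (forall s x, I s -> 0 < rho s x) ->
  jC1 I (fun s x => g (rho s x)).
Proof.
move=> oI cg jrho rho0; apply: (jC1_comp oI jrho rho0 cg.1).
exact: C1_derive1_continuous.
Qed.

End internal_energy.

Section solution.
Context (R : realType) (d : nat) (beta : R) (K : 'rV[R]_d -> R).
Hypothesis hK : green_function beta K.
Variables (h : R -> R) (hh : smooth_on [set r : R | 0 < r] h).
Variables (I : set R) (hI : open I).
Variables (rho : R -> 'rV[R]_d -> R) (u : R -> 'rV[R]_d -> 'rV[R]_d)
  (c : R -> 'rV[R]_d -> R).
Hypothesis hc : forall t x, I t -> c t x = tconv K (rho t) x.
Hypothesis hsol : euler_poisson beta h I rho u c.

Lemma jC1_density : jC1 I rho.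
Proof. exact: (jC1_smooth (ep_rho_periodic hsol) (ep_rho_smooth hsol)). Qed.

Lemma jC1_velocity i : jC1 I (fun s x => u s x 0 i).
Proof. exact: (jC1_component hI i (ep_u_periodic hsol) (ep_u_smooth hsol)). Qed.

Lemma potentialE s : I s -> c s = tconv K (rho s).
Proof. by move=> Is; apply/funext => x; exact: hc. Qed.

Lemma solution_elliptic_pair s : I s -> elliptic_pair beta (rho s) (tconv K (rho s)).
Proof.
move=> Is; apply: elliptic_solution_pair.
  exact/tC1_cont/(jC1_slice jC1_density Is).
apply: (green_solves hK); first exact: (ep_rho_periodic hsol).
exact: (smooth_slice Is (ep_rho_smooth hsol)).
Qed.

Lemma mass_balance t x : I t ->
  tder rho t x = - \sum_i partial i (fun y => rho t y * u t y 0 i) x.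
Proof.
move=> It; rewrite (tderE x jC1_density It); apply/eqP; rewrite -addr_eq0.
rewrite -[X in _ == X](ep_mass hsol x It) /diverg; apply/eqP; congr (_ + _).
apply: eq_bigr => i _; congr (partial i _ x).
by apply/funext => y; rewrite mxE.
Qed.

Lemma density_partial (g : R -> R) i t x : I t -> C1_on [set r : R | 0 < r] g ->
  partial i (fun y => g (rho t y)) x = derive1 g (rho t x) * partial i (rho t) x.
Proof.
move=> It cg; apply: dir_comp; first exact: (tC1_diff x (jC1_slice jC1_density It)).
exact: (cg.1 _ (ep_rho_gt0 hsol x It)).
Qed.

Lemma enthalpy_gradient i t x : I t ->
  partial i (fun y => pressure h (rho t y)) x =
  rho t x * partial i (fun y => derive1 h (rho t y)) x.
Proof.
move=> It; rewrite (density_partial i x It (C1_pressure hh)).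
rewrite (density_partial i x It (C1_dh hh)) (derive1_pressure hh) ?mulrA//.
exact: (ep_rho_gt0 hsol x It).
Qed.

(** The momentum equation divided by the density, in which the pressure force becomes
    the gradient of the enthalpy h'(rho). *)
Lemma acceleration i t x : I t -> tder (fun s x => u s x 0 i) t x =
  - (\sum_j u t x 0 j * partial j (fun y => u t y 0 i) x)
  - partial i (fun y => derive1 h (rho t y)) x + partial i (c t) x.
Proof.
move=> It; have rho0 := ep_rho_gt0 hsol x It.
have /(congr1 (fun w : 'rV[R]_d => w 0 i)) := ep_momentum hsol x It.
have du : derivable (fun s => u s x) t 1.
  apply/derivable_mxP => a j; rewrite (ord1 a).
  by case: (jC1_is_derive x (jC1_velocity j) It).
rewrite !mxE (enthalpy_gradient i x It) derive1E (derive_mx du) mxE.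
rewrite (tderE x (jC1_velocity i) It) derive1E.
rewrite -mulrN -mulrDr => /(mulfI (lt0r_neq0 rho0)) /(canRL (addrK _)) ->.
by rewrite addrC addrA.
Qed.

End solution.

(** * The relative energy identity *)
Lemma elliptic_pairB (R : realType) (d : nat) (beta : R)
    (a A b B : 'rV[R]_d -> R) :
  elliptic_pair beta a A -> elliptic_pair beta b B ->
  elliptic_pair beta (fun x => a x - b x) (fun x => A x - B x).
Proof.
move=> [ca cA c2A eA mA] [cb cB c2B eB mB].
have E i : partial i (fun x => A x - B x) = (fun x => partial i A x - partial i B x).
  by apply/funext => x; exact: partialB.
split=> [||i|x|].
- exact: tcontB.
- exact: tC1B.
- by rewrite E; exact: (tC1B (c2A i) (c2B i)).
- rewrite /mean (tintB ca cb).
  have -> : lap (fun x => A x - B x) x = lap A x - lap B x.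
    rewrite /lap -sumrB; apply: eq_bigr => i _; rewrite E.
    exact: (partialB i x (c2A i) (c2B i)).
  move: (eA x) (eB x); rewrite /mean.
  move: (lap A x) (lap B x) (A x) (B x) (a x) (b x) (tint a) (tint b).
  move=> l1 l2 A1 B1 a1 b1 m1 m2 E1 E2.
  transitivity ((- l1 + beta * A1) - (- l2 + beta * B1)); first by ring.
  by rewrite E1 E2; ring.
- by rewrite (tintB (tC1_cont cA) (tC1_cont cB)) mA mB subrr.
Qed.

Section relative_energy.
Context (R : realType) (d : nat) (beta : R) (K : 'rV[R]_d -> R).
Hypothesis hK : green_function beta K.
Variables (h : R -> R) (hh : smooth_on [set r : R | 0 < r] h).
Variables (I : set R) (hI : open I).
Variables (rho rhob : R -> 'rV[R]_d -> R) (u ub : R -> 'rV[R]_d -> 'rV[R]_d)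
  (c cb : R -> 'rV[R]_d -> R).
Hypothesis hc : forall t x, I t -> c t x = tconv K (rho t) x.
Hypothesis hcb : forall t x, I t -> cb t x = tconv K (rhob t) x.
Hypothesis hsol : euler_poisson beta h I rho u c.
Hypothesis hsolb : euler_poisson beta h I rhob ub cb.

Let r s x := rho s x - rhob s x.
Let C s := tconv K (r s).
Let U2 s x := \sum_i ((u s x 0 i - ub s x 0 i) * (u s x 0 i - ub s x 0 i)).

Let jrho := jC1_density hsol.
Let jrhob := jC1_density hsolb.
Let ju i := jC1_velocity hI hsol i.
Let jub i := jC1_velocity hI hsolb i.
Let jr : jC1 I r. Proof. exact: (jC1B hI jrho jrhob). Qed.
Let jU i : jC1 I (fun s x => u s x 0 i - ub s x 0 i).
Proof. exact: (jC1B hI (ju i) (jub i)). Qed.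
Let jUU i : jC1 I (fun s x =>
  (u s x 0 i - ub s x 0 i) * (u s x 0 i - ub s x 0 i)).
Proof. exact: (jC1M hI (jU i) (jU i)). Qed.
Let jU2 : jC1 I U2. Proof. exact: (jC1_sum hI jUU). Qed.

Let ja : jC1 I (fun s x => derive1 h (rho s x)).
Proof. exact: (jC1_of_density hI (C1_dh hh) jrho (ep_rho_gt0 hsol)). Qed.
Let jb : jC1 I (fun s x => derive1 h (rhob s x)).
Proof. exact: (jC1_of_density hI (C1_dh hh) jrhob (ep_rho_gt0 hsolb)). Qed.
Let jh : jC1 I (fun s x => h (rho s x)).
Proof. exact: (jC1_of_density hI (C1_h hh) jrho (ep_rho_gt0 hsol)). Qed.
Let jhb : jC1 I (fun s x => h (rhob s x)).
Proof. exact: (jC1_of_density hI (C1_h hh) jrhob (ep_rho_gt0 hsolb)). Qed.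
Let jp : jC1 I (fun s x => pressure h (rho s x)).
Proof. exact: (jC1_of_density hI (C1_pressure hh) jrho (ep_rho_gt0 hsol)). Qed.
Let jq : jC1 I (fun s x => pressure h (rhob s x)).
Proof. exact: (jC1_of_density hI (C1_pressure hh) jrhob (ep_rho_gt0 hsolb)). Qed.

(** The part of the relative energy density that is local in x; the interaction term is
    treated by [is_derive_interaction]. *)
Definition local_energy (s : R) (x : 'rV[R]_d) : R :=
  (h (rho s x) - h (rhob s x) - derive1 h (rhob s x) * r s x)
  + 2^-1 * (rho s x * U2 s x).

Let jhh : jC1 I (fun s x => h (rho s x) - h (rhob s x)).
Proof. exact: (jC1B hI jh jhb). Qed.
Let jbr : jC1 I (fun s x => derive1 h (rhob s x) * r s x).
Proof. exact: (jC1M hI jb jr). Qed.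
Let jrel : jC1 I (fun s x =>
  h (rho s x) - h (rhob s x) - derive1 h (rhob s x) * r s x).
Proof. exact: (jC1B hI jhh jbr). Qed.
Let jrU : jC1 I (fun s x => rho s x * U2 s x).
Proof. exact: (jC1M hI jrho jU2). Qed.
Let j2 : jC1 I (fun (_ : R) (_ : 'rV[R]_d) => (2^-1 : R)).
Proof. exact: (jC1_cst d hI). Qed.
Let jkin : jC1 I (fun s x => 2^-1 * (rho s x * U2 s x)).
Proof. exact: (jC1M hI j2 jrU). Qed.

Lemma jC1_local_energy : jC1 I local_energy.
Proof. exact: (jC1D hI jrel jkin). Qed.

Lemma tder_local_energy t x : I t -> tder local_energy t x =
  (derive1 h (rho t x) - derive1 h (rhob t x)) * tder rho t x
  - derive1 (derive1 h) (rhob t x) * tder rhob t x * (rho t x - rhob t x)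
  + 2^-1 * (tder rho t x * U2 t x)
  + rho t x * (\sum_i (u t x 0 i - ub t x 0 i) *
      (tder (fun s x => u s x 0 i) t x - tder (fun s x => ub s x 0 i) t x)).
Proof.
move=> It.
have p0 := ep_rho_gt0 hsol x It; have q0 := ep_rho_gt0 hsolb x It.
rewrite /local_energy (tderD x jrel jkin It) (tderB x jhh jbr It).
rewrite (tderB x jh jhb It) (tderM x jb jr It) (tderM x j2 jrU It).
rewrite (tderM x jrho jU2 It) tder_cst mul0r addr0.
rewrite (tder_comp jrho It ((C1_h hh).1 _ p0)).
rewrite (tder_comp jrhob It ((C1_h hh).1 _ q0)).
rewrite (tder_comp jrhob It ((C1_dh hh).1 _ q0)).
rewrite (tderB x jrho jrhob It) (tder_sum x jUU It).
have -> : \sum_i tder (fun s x =>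
    (u s x 0 i - ub s x 0 i) * (u s x 0 i - ub s x 0 i)) t x =
  2 * \sum_i (u t x 0 i - ub t x 0 i) *
      (tder (fun s x => u s x 0 i) t x - tder (fun s x => ub s x 0 i) t x).
  rewrite mulr_sumr; apply: eq_bigr => i _.
  by rewrite (tderM x (jU i) (jU i) It) (tderB x (ju i) (jub i) It); ring.
rewrite /r; move: (\sum_i _) (U2 t x) => S1 S2.
by field.
Qed.

Let pK := green_periodic hK.
Let iK := green_integrable hK.
Let sK := green_symmetric hK.

Lemma potential_difference s : I s -> (fun y => c s y - cb s y) = C s.
Proof.
move=> Is; apply/funext => y; rewrite (hc y Is) (hcb y Is).
rewrite -(tconvB pK iK sK)//.
- exact: (tC1_cont (jC1_slice jrho Is)).
- exact: (tC1_cont (jC1_slice jrhob Is)).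
Qed.

(** By linearity, r and C = c - cb solve the same elliptic problem. *)
Lemma difference_elliptic_pair s : I s -> elliptic_pair beta (r s) (C s).
Proof.
move=> Is; rewrite -(potential_difference Is).
rewrite (potentialE hc Is) (potentialE hcb Is).
exact: (elliptic_pairB (solution_elliptic_pair hK hsol Is)
  (solution_elliptic_pair hK hsolb Is)).
Qed.

Variables (t : R) (It : I t).

Let divub x := \sum_i partial i (fun y => ub t y 0 i) x.
Let k x := derive1 (derive1 h) (rhob t x).
Let m := mean (r t).

(** The three integrands of the right-hand side, in components and with C in place of
    c - cb. *)
Definition bulk x : R := divub x *
  (- (pressure h (rho t x) - pressure h (rhob t x) - rhob t x * k x * (rho t x - rhob t x))
   + 2^-1 * \sum_j (partial j (C t) x * partial j (C t) x)
   + beta / 2 * C t x ^+ 2 + m * C t x).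
Definition stress x : R := \sum_i \sum_j
  partial j (fun y => ub t y 0 i) x * (partial i (C t) x * partial j (C t) x).
Definition reynolds x : R := rho t x * (\sum_i \sum_j
  partial j (fun y => ub t y 0 i) x *
    ((u t x 0 i - ub t x 0 i) * (u t x 0 j - ub t x 0 j))).

Let cC : tC1 (C t). Proof. exact: pair_C1 (difference_elliptic_pair It). Qed.
Let cDC i : tC1 (partial i (C t)).
Proof. exact: (pair_C2 (difference_elliptic_pair It) i). Qed.
Let cu i : tC1 (fun y => u t y 0 i). Proof. exact: (jC1_slice (ju i) It). Qed.
Let cub i : tC1 (fun y => ub t y 0 i). Proof. exact: (jC1_slice (jub i) It). Qed.
Let crho : tC1 (rho t). Proof. exact: (jC1_slice jrho It). Qed.
Let crhob : tC1 (rhob t). Proof. exact: (jC1_slice jrhob It). Qed.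
Let ca : tC1 (fun x => derive1 h (rho t x)). Proof. exact: (jC1_slice ja It). Qed.
Let cb' : tC1 (fun x => derive1 h (rhob t x)). Proof. exact: (jC1_slice jb It). Qed.
Let cp : tC1 (fun x => pressure h (rho t x)). Proof. exact: (jC1_slice jp It). Qed.
Let cq : tC1 (fun x => pressure h (rhob t x)). Proof. exact: (jC1_slice jq It). Qed.

Let flux := entropy_flux beta m (rho t) (rhob t)
  (fun x => derive1 h (rho t x)) (fun x => derive1 h (rhob t x))
  (fun x => pressure h (rho t x)) (fun x => pressure h (rhob t x)) (C t)
  (fun i y => u t y 0 i) (fun i y => ub t y 0 i).

Lemma relative_energy_balance x :
  tder local_energy t x - tder r t x * C t x - (bulk x - stress x - reynolds x) =
  \sum_i partial i (flux i) x.
Proof.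
have h1 i y := enthalpy_gradient hh hsol i y It.
have h2 i y := enthalpy_gradient hh hsolb i y It.
have h3 i y : partial i (fun z => derive1 h (rhob t z)) y = k y * partial i (rhob t) y.
  exact: (density_partial hsolb i y It (C1_dh hh)).
have h4 i j y : partial i (partial j (C t)) y = partial j (partial i (C t)) y.
  exact: (@dir_commute R 'rV[R]_d (C t) (unit_vec R i) (unit_vec R j) y
    (fun z => tC1_diff z cC) (cDC i).2 (cDC j).2).
have h5 y : - lap (C t) y + beta * C t y = (rho t y - rhob t y) - m.
  exact: (pair_pde (difference_elliptic_pair It)).
have h6 y := mass_balance hsol y It.
have h7 y := mass_balance hsolb y It.
have h8 i y : tder (fun s x => u s x 0 i) t y - tder (fun s x => ub s x 0 i) t y =
    - (\sum_j u t y 0 j * partial j (fun z => u t z 0 i) y)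
    + (\sum_j ub t y 0 j * partial j (fun z => ub t z 0 i) y)
    - (partial i (fun z => derive1 h (rho t z)) y
       - partial i (fun z => derive1 h (rhob t z)) y)
    + partial i (C t) y.
  rewrite (acceleration hh hI hsol i y It) (acceleration hh hI hsolb i y It).
  have -> : partial i (C t) y = partial i (c t) y - partial i (cb t) y.
    rewrite -(potential_difference It); apply: partialB.
      by rewrite (potentialE hc It); exact: pair_C1 (solution_elliptic_pair hK hsol It).
    by rewrite (potentialE hcb It); exact: pair_C1 (solution_elliptic_pair hK hsolb It).
  move: (\sum_j _) (\sum_j _) => S1 S2.
  move: (partial i (c t) y) (partial i (cb t) y) => c1 c2.
  move: (partial i (fun z => derive1 h (rho t z)) y) => a1.
  move: (partial i (fun z => derive1 h (rhob t z)) y) => b1.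
  by ring.
rewrite (tder_local_energy x It) (tderB x jrho jrhob It).
exact: (@relative_energy_pointwise R d beta m (rho t) (rhob t)
  (fun x => derive1 h (rho t x)) (fun x => derive1 h (rhob t x))
  (fun x => pressure h (rho t x)) (fun x => pressure h (rhob t x)) k (C t)
  (tder rho t) (tder rhob t)
  (fun i y => u t y 0 i) (fun i y => ub t y 0 i)
  (fun i x => tder (fun s x => u s x 0 i) t x)
  (fun i x => tder (fun s x => ub s x 0 i) t x)
  crho crhob ca cb' cp cq cC cDC cu cub h1 h2 h3 h4 h5 h6 h7 h8 x).
Qed.

Let k1 : tcont (fun x => rhob t x * k x * (rho t x - rhob t x)).
Proof.
have cq' : tcont (fun x => derive1 (pressure h) (rhob t x)).
  split=> [x i|x]; first by rewrite (ep_rho_periodic hsolb It).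
  apply: (@continuous_comp _ _ _ (rhob t) (derive1 (pressure h))).
    exact: (tC1_cont crhob).2.
  exact: (C1_derive1_continuous (C1_pressure hh) (ep_rho_gt0 hsolb x It)).
have -> : (fun x => rhob t x * k x * (rho t x - rhob t x)) =
    (fun x => derive1 (pressure h) (rhob t x) * (rho t x - rhob t x)).
  apply/funext => x.
  by rewrite (derive1_pressure hh (ep_rho_gt0 hsolb x It)).
exact: (tcontM cq' (tC1_cont (tC1B crho crhob))).
Qed.

Let tcont_bulk : tcont bulk.
Proof.
have kd : tcont divub.
  by apply: tcont_sum => i; exact: (tC1_partial i (cub i)).
have kg : tcont (fun x => \sum_j (partial j (C t) x * partial j (C t) x)).
  by apply: tcont_sum => j; exact: (tC1_cont (tC1M (cDC j) (cDC j))).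
have kCC : tcont (fun x => C t x ^+ 2).
  exact: (tC1_cont (tC1M cC cC)).
have e1 := tcontN (tcontB (tC1_cont (tC1B cp cq)) k1).
have e2 := tcontD e1 (tcontM (tcont_cst d 2^-1) kg).
have e3 := tcontD e2 (tcontM (tcont_cst d (beta / 2)) kCC).
have e4 := tcontD e3 (tcontM (tcont_cst d m) (tC1_cont cC)).
exact: (tcontM kd e4).
Qed.

Let tcont_stress : tcont stress.
Proof.
apply: tcont_sum => i; apply: tcont_sum => j.
exact: (tcontM (tC1_partial j (cub i)) (tC1_cont (tC1M (cDC i) (cDC j)))).
Qed.

Let tcont_reynolds : tcont reynolds.
Proof.
have cU i : tC1 (fun x => u t x 0 i - ub t x 0 i) := tC1B (cu i) (cub i).
apply: (tcontM (tC1_cont crho)).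
apply: tcont_sum => i; apply: tcont_sum => j.
exact: (tcontM (tC1_partial j (cub i)) (tC1_cont (tC1M (cU i) (cU j)))).
Qed.

Lemma integrated_balance :
  tint (tder local_energy t) - tint (fun x => tder r t x * C t x) =
  tint bulk - tint stress - tint reynolds.
Proof.
have kE := tder_cont hI jC1_local_energy It.
have kI : tcont (fun x => tder r t x * C t x).
  exact: (tcontM (tder_cont hI jr It) (tC1_cont cC)).
have kR1 := tcontB tcont_bulk tcont_stress.
rewrite -(tintB tcont_bulk tcont_stress) -(tintB kR1 tcont_reynolds) -(tintB kE kI).
apply/eqP; rewrite -subr_eq0 -(tintB (tcontB kE kI) (tcontB kR1 tcont_reynolds)).
rewrite (eq_tint relative_energy_balance); apply/eqP; apply: tint_divergence.
by move=> i; exact: (tC1_entropy_flux beta m crho crhob ca cb' cp cq cC cDC cu cub).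
Qed.

Lemma relative_energyE s : I s ->
  tint (fun x => relative h (rho s x) (rhob s x)
    - 2^-1 * (rho s x - rhob s x) * tconv K (fun y => rho s y - rhob s y) x
    + 2^-1 * rho s x * sqnorm (u s x - ub s x)) =
  tint (local_energy s) - 2^-1 * tint (fun x => r s x * C s x).
Proof.
move=> Is; have pC := difference_elliptic_pair Is.
have kE := tC1_cont (jC1_slice jC1_local_energy Is).
have kI : tcont (fun x => r s x * C s x).
  exact: (tcontM (pair_source pC) (tC1_cont (pair_C1 pC))).
rewrite -(tintZ 2^-1 kI) -(tintB kE (tcontM (tcont_cst d 2^-1) kI)).
apply: eq_tint => x.
have -> : sqnorm (u s x - ub s x) = U2 s x.
  by rewrite /sqnorm /dot; apply: eq_bigr => i _; rewrite !mxE.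
rewrite /local_energy /relative -/(r s x) -/(r s) -/(C s).
by move: (U2 s x) (C s x) => S1 C1; ring.
Qed.

Lemma relative_energy_identity :
  is_derive t 1
    (fun s : R => tint (fun x => relative h (rho s x) (rhob s x)
    - 2^-1 * (rho s x - rhob s x) * tconv K (fun y => rho s y - rhob s y) x
    + 2^-1 * rho s x * sqnorm (u s x - ub s x)))
    (tint bulk - tint stress - tint reynolds).
Proof.
rewrite -integrated_balance.
have dE := is_derive_tint_jC1 hI jC1_local_energy It.
have [q1 q2] := is_derive_interaction pK iK sK hI It jr difference_elliptic_pair.
have dQ : is_derive t 1 (fun s => 2^-1 * tint (fun x => r s x * C s x))
    (tint (fun x => tder r t x * C t x)).
  have c2 : derivable (cst (2^-1 : R)) t 1 by exact: derivable_cst.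
  apply: DeriveDef; first exact: (derivableM c2 q1).
  rewrite (deriveM c2 q1) derive_cst scaler0 addr0 q2.
  by rewrite /GRing.scale/= mulKf// pnatr_eq0.
apply: (near_eq_is_derive _ (is_deriveB dE dQ)).
have := open_nbhs_nbhs (conj hI It); apply: filterS => s Is.
by rewrite /= (relative_energyE Is).
Qed.

End relative_energy.

Theorem mainTheorem8 (R : realType) (d : nat) (beta : R) (hbeta : 0 <= beta)
  (K : 'rV[R]_d -> R) (hK : green_function beta K)
  (h : R -> R) (hh : smooth_on [set r : R | 0 < r] h)
  (I : set R) (hI : open I)
  (rho rhob : R -> 'rV[R]_d -> R) (u ub : R -> 'rV[R]_d -> 'rV[R]_d)
  (c cb : R -> 'rV[R]_d -> R)
  (hc : forall t x, I t -> c t x = tconv K (rho t) x)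
  (hcb : forall t x, I t -> cb t x = tconv K (rhob t) x)
  (hsol : euler_poisson beta h I rho u c)
  (hsolb : euler_poisson beta h I rhob ub cb)
  (t : R) (ht : I t) :
  is_derive t 1
    (fun s : R => tint (fun x =>
       relative h (rho s x) (rhob s x)
       - 2^-1 * (rho s x - rhob s x) * tconv K (fun y => rho s y - rhob s y) x
       + 2^-1 * rho s x * sqnorm (u s x - ub s x)))
    (tint (fun x => diverg (ub t) x *
        (- relative (pressure h) (rho t x) (rhob t x)
         + 2^-1 * sqnorm (grad (fun y => c t y - cb t y) x)
         + beta / 2 * (c t x - cb t x) ^+ 2
         + mean (fun y => rho t y - rhob t y) * (c t x - cb t x)))
     - tint (fun x => ddot (gradv (ub t) x)
         (tensor (grad (fun y => c t y - cb t y) x)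
                 (grad (fun y => c t y - cb t y) x)))
     - tint (fun x => rho t x * ddot (gradv (ub t) x)
         (tensor (u t x - ub t x) (u t x - ub t x)))).
Proof.
have E := potential_difference hK hc hcb hsol hsolb ht.
have Ex x : c t x - cb t x = tconv K (fun y => rho t y - rhob t y) x.
  exact: (congr1 (fun f => f x) E).
have G x : sqnorm (grad (fun y => c t y - cb t y) x) =
    \sum_j (partial j (tconv K (fun y => rho t y - rhob t y)) x *
            partial j (tconv K (fun y => rho t y - rhob t y)) x).
  by rewrite E /sqnorm /dot; apply: eq_bigr => j _; rewrite !mxE.
have -> : tint (fun x => diverg (ub t) x *
    (- relative (pressure h) (rho t x) (rhob t x)
     + 2^-1 * sqnorm (grad (fun y => c t y - cb t y) x)
     + beta / 2 * (c t x - cb t x) ^+ 2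
     + mean (fun y => rho t y - rhob t y) * (c t x - cb t x))) =
    tint (bulk beta K h rho rhob ub t).
  apply: eq_tint => x; rewrite G Ex /bulk /relative.
  by rewrite (derive1_pressure hh (ep_rho_gt0 hsolb x ht)).
have -> : tint (fun x => ddot (gradv (ub t) x)
    (tensor (grad (fun y => c t y - cb t y) x)
            (grad (fun y => c t y - cb t y) x))) = tint (stress K rho rhob ub t).
  apply: eq_tint => x; rewrite E /ddot /stress.
  by apply: eq_bigr => i _; apply: eq_bigr => j _; rewrite !mxE.
have -> : tint (fun x => rho t x * ddot (gradv (ub t) x)
    (tensor (u t x - ub t x) (u t x - ub t x))) = tint (reynolds rho u ub t).
  apply: eq_tint => x; rewrite /ddot /reynolds; congr (_ * _).
  by apply: eq_bigr => i _; apply: eq_bigr => j _; rewrite !mxE.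
exact: (relative_energy_identity hK hh hI hc hcb hsol hsolb ht).
Qed.
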